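(* Let $k\ge 1$, let $\alpha_1,\dots,\alpha_k>0$ and $\lambda_1,\dots,\lambda_k>0$, and let $X_1,\dots,X_k$ be independent gamma random variables such that $X_j$ has the probability density $\lambda_j^{-1} g_{\alpha_j}(\lambda_j^{-1}x)$, $x>0$, where $g_{\alpha}(x)=e^{-x}x^{\alpha-1}/\Gamma(\alpha)$. Put $\lambda_{\max}=\max_j\lambda_j$, $\lambda_{\min}=\min_j\lambda_j$, $$v=\tfrac12\left(\lambda_{\max}^{-1}+\lambda_{\min}^{-1}\right),\qquad \alpha=\sum_{j=1}^k\alpha_j,\qquad c_j=1-\frac{1}{v\lambda_j}\quad (j=1,\dots,k).$$ Then for every $r\in\left(\frac{\lambda_{\max}-\lambda_{\min}}{\lambda_{\max}+\lambda_{\min}},\,1\right)$ and every $x\ge 0$, the cumulative distribution function $F(x;\alpha_1,\dots,\alpha_k,\lambda_1,\dots,\lambda_k)=P\{\sum_{j=1}^k X_j\le x\}$ is given by $$F(x;\alpha_1,\dots,\alpha_k,\lambda_1,\dots,\lambda_k)=\left(v^{-\alpha}\prod_{j=1}^k\lambda_j^{-\alpha_j}\right)\frac1\pi\int_0^\pi \mathrm{Re}\left(\prod_{j=1}^k\left(1-c_jr^{-1}e^{-i\varphi}\right)^{-\alpha_j}\, G_\alpha(vx,re^{i\varphi})\right)d\varphi .$$ In particular, let $X$ be an $N_k(0,\Sigma)$-distributed random vector with positive definite covariance matrix $\Sigma$, let $C$ be a positive definite $k\times k$ matrix, let $Q=X'CX$, and let $\lambda_1,\dots,\lambda_k$ be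 the eigenvalues of $\Sigma^{1/2}C\Sigma^{1/2}$, with $\lambda_{\max},\lambda_{\min},v,c_j$ defined from these $\lambda_j$ by the same formulas. Then for every $r\in\left(\frac{\lambda_{\max}-\lambda_{\min}}{\lambda_{\max}+\lambda_{\min}},\,1\right)$ and every $x\ge0$, the cumulative distribution function $F(x;\tfrac12,\lambda_1,\dots,\lambda_k)=P\{\tfrac12Q\le x\}$ is given by $$F(x;\tfrac12,\lambda_1,\dots,\lambda_k)=\left(v^{-k/2}|C\Sigma|^{-1/2}\right)\frac1\pi\int_0^\pi \mathrm{Re}\left(\prod_{j=1}^k\left(1-c_jr^{-1}e^{-i\varphi}\right)^{-1/2}\, G_{k/2}(vx,re^{i\varphi})\right)d\varphi .$$
   Context: For $\alpha>0$ and $x\ge0$, $G_\alpha(x)=\int_0^x g_\alpha(t)\,dt$ denotes the cumulative distribution function of the gamma density $g_\alpha(t)=e^{-t}t^{\alpha-1}/\Gamma(\alpha)$, $t>0$. For $\alpha>0$, $x\ge 0$ and $y\in\mathbb{C}$ the two-argument function $G_\alpha(x,y)$ is defined by $$G_\alpha(x,y)=\sum_{n=0}^\infty G_{\alpha+n}(x)\,y^n$$ (only values $|y|<1$ are needed). The powers $(1-c_jr^{-1}e^{-i\varphi})^{-\alpha_j}$ are principal values, i.e. given by the binomial series $\sum_{n\ge0}\binom{\alpha_j+n-1}{n}(c_jr^{-1}e^{-i\varphi})^n$; note that $|c_j|\le\frac{\lambda_{\max}-\lambda_{\min}}{\lambda_{\max}+\lambda_{\min}}<r$. $|M|$ denotes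 the determinant of a matrix $M$, $X'$ is the transpose of $X$, $N_k(0,\Sigma)$ is the $k$-dimensional centered Gaussian distribution with covariance matrix $\Sigma$, and positive definite matrices are real symmetric. *)

(* Defs.v *)
From HB Require Import structures.
From mathcomp Require Import all_boot all_order all_algebra.
From mathcomp Require Import all_classical all_reals all_analysis.
From mathcomp Require Import complex.

Set Implicit Arguments.
Unset Strict Implicit.
Unset Printing Implicit Defensive.

Import Order.TTheory GRing.Theory Num.Theory.
Import numFieldNormedType.Exports.

Local Open Scope classical_set_scope.
Local Open Scope ring_scope.
Local Open Scope complex_scope.

Definition gamma_fun (R : realType) (a : R) : R :=
  \int[lebesgue_measure]_(t in `]0, +oo[) (expR (- t) * t `^ (a - 1)).

(* The gamma density; only its values at t > 0 are ever used. *)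
Definition gamma_pdf (R : realType) (a t : R) : R :=
  expR (- t) * t `^ (a - 1) / gamma_fun a.

Definition gamma_cdf (R : realType) (a x : R) : R :=
  \int[lebesgue_measure]_(t in `]0, x]) gamma_pdf a t.

(* R[i]^o is R[i] with the topology of the complex modulus. *)
Definition complex_series (R : realType) (u : nat -> R[i]) : R[i] :=
  limn (series u : nat -> R[i]^o).

Definition gamma_cdf2 (R : realType) (a x : R) (y : R[i]) : R[i] :=
  complex_series (fun n => (gamma_cdf (a + n%:R) x)%:C * y ^+ n).

Definition gbinom (R : realType) (a : R) (n : nat) : R :=
  (\prod_(i < n) (a - i%:R)) / n`!%:R.

(* The principal value of (1 - z)^(-a), for |z| < 1. *)
Definition pow1B (R : realType) (a : R) (z : R[i]) : R[i] :=
  complex_series (fun n => (gbinom (a + n%:R - 1) n)%:C * z ^+ n).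

(* e^(i phi) *)
Definition cis (R : realType) (phi : R) : R[i] := cos phi +i* sin phi.

(* Maximum and minimum of a nonempty finite family (of value 0 when k = 0). *)
Definition fmax (R : realType) (k : nat) (lam : 'I_k -> R) : R :=
  \big[Num.max/head 0 (codom lam)]_(j < k) lam j.

Definition fmin (R : realType) (k : nat) (lam : 'I_k -> R) : R :=
  \big[Num.min/head 0 (codom lam)]_(j < k) lam j.

Definition vpar (R : realType) (k : nat) (lam : 'I_k -> R) : R :=
  2^-1 * ((fmax lam)^-1 + (fmin lam)^-1).

Definition cpar (R : realType) (k : nat) (lam : 'I_k -> R) (j : 'I_k) : R :=
  1 - (vpar lam * lam j)^-1.

(* (1/pi) int_0^pi Re(prod_j (1 - c_j r^-1 e^(-i phi))^(-a_j)
                      G_alpha(v x, r e^(i phi))) dphi *)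
Definition polar_integral (R : realType) (k : nat) (a lam : 'I_k -> R)
    (alpha r x : R) : R :=
  pi^-1 * \int[lebesgue_measure]_(phi in `[0, pi])
    complex.Re
      ((\prod_(j < k) pow1B (a j) ((cpar lam j / r)%:C * cis (- phi)))
       * gamma_cdf2 alpha (vpar lam * x) (r%:C * cis phi)).

Definition has_density_on d (T : measurableType d) (R : realType)
    (P : probability T R) (X : {RV P >-> R}) (D : set R) (f : R -> R) : Prop :=
  forall A : set R, measurable A ->
    P (X @^-1` A) = (\int[lebesgue_measure]_(x in A `&` D) (f x)%:E)%E.

Definition mutually_independent d (T : measurableType d) (R : realType)
    (P : probability T R) (k : nat) (X : 'I_k -> {RV P >-> R}) : Prop :=
  forall (J : {set 'I_k}) (B : 'I_k -> set R),
    (forall j, measurable (B j)) ->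
    P (\bigcap_(j in [set` J]) (X j @^-1` B j)) =
    (\prod_(j in J) P (X j @^-1` B j))%E.

Definition posdefmx (R : realType) (k : nat) (A : 'M[R]_k) : Prop :=
  A^T = A /\ forall u : 'cV[R]_k, u != 0 -> 0 < (u^T *m A *m u) 0 0.

(* S = A^(1/2), for A positive definite. *)
Definition is_sqrtmx (R : realType) (k : nat) (S A : 'M[R]_k) : Prop :=
  posdefmx S /\ S *m S = A.

(* lam lists the eigenvalues of A with their multiplicities. *)
Definition is_spectrum (R : realType) (k : nat) (A : 'M[R]_k)
    (lam : 'I_k -> R) : Prop :=
  char_poly A = \prod_(j < k) ('X - (lam j)%:P).

(* Iterated integral over R^k: by Tonelli it is the integral against the
   k-dimensional Lebesgue measure when f is nonnegative and Borel. *)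
Fixpoint integral_tuple (R : realType) (k : nat) :
    (k.-tuple R -> \bar R) -> \bar R :=
  match k with
  | 0%N => fun f => f [tuple]
  | k'.+1 => fun f => (\int[lebesgue_measure]_x
               integral_tuple (fun u : k'.-tuple R => f [tuple of x :: u]))%E
  end.

(* Density of N_k(0, Sigma), for Sigma positive definite. *)
Definition gaussian_pdf (R : realType) (k : nat) (Sigma : 'M[R]_k)
    (u : k.-tuple R) : R :=
  let w := \col_j tnth u j in
  (2 * pi) `^ (- (k%:R / 2)) * (\det Sigma) `^ (- 2^-1) *
  expR (- (2^-1 * (w^T *m invmx Sigma *m w) 0 0)).

(* The random vector (X_1, ..., X_k) is N_k(0, Sigma)-distributed, for Sigma
   positive definite; A ranges over the Borel subsets of R^k. *)
Definition gaussian_vector d (T : measurableType d) (R : realType)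
    (P : probability T R) (k : nat) (X : 'I_k -> {RV P >-> R})
    (Sigma : 'M[R]_k) : Prop :=
  forall A : set (k.-tuple R), measurable A ->
    P [set t | A [tuple X j t | j < k]] =
    integral_tuple (fun u => (gaussian_pdf Sigma u * \1_A u)%:E).

Definition quad_form (R : realType) (T : Type) (k : nat) (C : 'M[R]_k)
    (X : 'I_k -> T -> R) (t : T) : R :=
  let w := \col_j X j t in (w^T *m C *m w) 0 0.

(* Main.v *)
(* Both claims are computations of Laplace transforms at natural numbers m.  By
   independence, resp. by a Gaussian integral and the identity
   |I + m M C M| = prod_j (1 + m lam_j), the law at hand has Laplace transform
   prod_j (1 + m lam_j)^(- a_j).  If e_n are the Taylor coefficients of
   prod_j (1 - c_j z)^(- a_j), then orthogonality of the exponentials turns the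
   polar integral into sum_n e_n G_{alpha+n}(v x), a signed mixture of gamma
   distribution functions; by the binomial series, the Laplace transform of this
   mixture, times v^(- alpha) prod_j lam_j^(- a_j), is the same product.  Finally,
   the distribution function of a nonnegative variable is the limit of explicit
   finite linear combinations of the values of its Laplace transform at natural
   numbers. *)
Require Import Defs.
From mathcomp Require Import all_boot all_order all_algebra.
From mathcomp Require Import all_classical all_reals all_analysis.
From mathcomp Require Import measurable_realfun complex ring lra.

Import Order.TTheory GRing.Theory Num.Theory.
Import numFieldNormedType.Exports.

Set Implicit Arguments.
Unset Strict Implicit.
Unset Printing Implicit Defensive.

Local Open Scope classical_set_scope.
Local Open Scope ring_scope.

(** With $s=1+m/v$ one has $1+m\lambda_j=v\lambda_j\,s\,(1-c_j/s)$. This identity is the origin of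
    $v$ and $c_j$: it turns $\prod_j(1+m\lambda_j)^{-a_j}$ into $v^{-\alpha}\prod_j\lambda_j^{-a_j}$
    times $\sum_n e_n s^{-(\alpha+n)}$, and $s^{-(\alpha+n)}$ is the transform at $m$ of a gamma
    variable of shape $\alpha+n$ divided by $v$. As $v$ is the midpoint of $1/\lambda_{\max}$ and
    $1/\lambda_{\min}$, the extreme $c_j$ are opposite. The radius shares out the convergence: in
    $e_n=p_nr^n$ the $p_n$ are absolutely summable because $|c_j|<r$, and $r<1$ gives the same to
    the series of gamma distribution functions. The $e_n$ may change sign, so the mixture is not
    treated as a law: its transform is inverted term by term, and every exchange of limits rests on
    absolute summability and a uniform bound. Inverting by one explicit sequence of finite
    combinations replaces a uniqueness theorem: equal transforms at the natural numbers have equal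
    combinations, hence equal limits. *)

(** * Absolutely summable real series and Tannery's theorem *)

Lemma cvgn_norm_le (R : realType) (u : R^nat) (l M : R) :
  u @ \oo --> l -> (forall n, `|u n| <= M) -> `|l| <= M.
Proof.
move=> ul uM; have h : (fun n => `|u n|) @ \oo --> `|l| by exact: cvg_norm.
rewrite -(cvg_lim _ h)//; apply: limr_le; first by apply/cvg_ex; eexists; exact: h.
exact: nearW.
Qed.

Definition abs_summable (R : realType) (u : R^nat) : Prop :=
  cvgn (series (fun n => `|u n|)).

Section abs_summable.
Variable R : realType.
Implicit Types u w : R^nat.

Lemma abs_summable_cvg u : abs_summable u -> cvgn (series u).
Proof. exact: normed_cvg. Qed.

Lemma abs_summable_le u w M : (forall n, `|w n| <= M * `|u n|) ->
  abs_summable u -> abs_summable w.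
Proof.
move=> wu su; apply: (@series_le_cvg _ _ (fun n => `|M| * `|u n|)).
- by move=> n; exact: normr_ge0.
- by move=> n; exact: mulr_ge0.
- by move=> n; apply: le_trans (wu n) _; rewrite ler_wpM2r// ler_norm.
- exact: (@is_cvg_seriesZ _ (fun n => `|u n|) `|M| su).
Qed.

Lemma abs_summable_norm u : abs_summable u -> abs_summable (fun n => `|u n|).
Proof. by apply: (@abs_summable_le _ _ 1) => n; rewrite normr_id mul1r. Qed.

Lemma series_norm_le u n : abs_summable u ->
  `|series u n| <= limn (series (fun n => `|u n|)).
Proof.
move=> su; apply: (@le_trans _ _ (series (fun n => `|u n|) n)).
  exact: ler_norm_sum.
apply: nondecreasing_cvgn_le => //.
by apply: nondecreasing_series => i _ _; exact: normr_ge0.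
Qed.

(** A single index [K] serves every sequence dominated by a multiple of [u]; this uniformity is what
    Tannery's theorem needs. *)
Lemma abs_summable_tail u (e : R) : abs_summable u -> 0 < e ->
  exists K, forall w B, 0 <= B -> (forall n, `|w n| <= B * `|u n|) ->
    `|limn (series w) - series w K| <= B * e.
Proof.
move=> su e0; set U := series (fun n => `|u n|).
have [K _ UK] : \forall k \near \oo, `|limn U - U k| < e.
  by move/cvgrPdist_lt: su; exact.
exists K => w B B0 wu.
have sw := abs_summable_cvg (abs_summable_le wu su).
have h : (fun n => `|series w n - series w K|) @ \oo --> `|limn (series w) - series w K|.
  by apply: cvg_norm; apply: cvgB => //; exact: cvg_cst.
rewrite -(cvg_lim _ h)//; apply: limr_le; first by apply/cvg_ex; eexists; exact: h.
near=> n; have Kn : (K <= n)%N by near: n; exact: nbhs_infty_ge.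
rewrite sub_series Kn; apply: le_trans (ler_norm_sum _ _ _) _.
apply: (@le_trans _ _ (B * \sum_(K <= k < n) `|u k|)).
  by rewrite mulr_sumr; apply: ler_sum.
apply: ler_wpM2l => //.
have -> : \sum_(K <= k < n) `|u k| = U n - U K by rewrite sub_series Kn.
apply: (@le_trans _ _ `|limn U - U K|); last exact/ltW/(UK K)/leqnn.
have ndU : nondecreasing_seq U.
  by apply: nondecreasing_series => i _ _; exact: normr_ge0.
rewrite ger0_norm ?lerD2r ?subr_ge0.
  exact: nondecreasing_cvgn_le.
exact: nondecreasing_cvgn_le.
Unshelve. all: by end_near. Qed.

(** Dominated convergence for series: beyond a fixed [K] the tails are small uniformly in [N], and
    the first [K] terms converge one by one. *)
Lemma tannery u (s : nat -> nat -> R) (l : nat -> R) (M : R) :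
  abs_summable u -> (forall N n, `|s N n| <= M) ->
  (forall n, s N n @[N --> \oo] --> l n) ->
  limn (series (fun n => u n * s N n)) @[N --> \oo] -->
  limn (series (fun n => u n * l n)).
Proof.
move=> su sM sl.
have M0 : 0 <= M by exact: le_trans (sM 0%N 0%N).
have lM n : `|l n| <= M.
  by apply: (cvgn_norm_le (sl n)) => N.
apply/cvgrPdist_le => e e0.
(* The differences are dominated by [2 * M] times [u], so the tail costs at most $2Me/(4(M+1))\le
   e/2$; the [+ 1] covers [M = 0]. *)
have M1 : 0 < 4 * (M + 1) by rewrite mulr_gt0// ltr_wpDl.
have [K hK] := abs_summable_tail su (divr_gt0 e0 M1).
pose w N n := u n * (l n - s N n).
have wu N n : `|w N n| <= (2 * M) * `|u n|.
  rewrite normrM mulrC ler_wpM2r//.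
  by rewrite (le_trans (ler_normB _ _))// mulr_natl mulr2n lerD.
have sw : series (w N) K @[N --> \oo] --> (0 : R).
  have -> : 0 = \sum_(0 <= k < K) u k * (l k - l k).
    by rewrite big1// => i _; rewrite subrr mulr0.
  apply: (@cvg_big R nat +%R 0 xpredT _ _ _ _ (fun k N => w N k)) => [|i _].
    exact: add_continuous.
  apply: cvgM; first exact: cvg_cst.
  by apply: cvgB; [exact: cvg_cst|exact: sl].
have ul : abs_summable (fun n => u n * l n).
  by apply: (abs_summable_le (M := M)) su => n; rewrite normrM mulrC ler_wpM2r.
have us N : abs_summable (fun n => u n * s N n).
  by apply: (abs_summable_le (M := M)) su => n; rewrite normrM mulrC ler_wpM2r.
have e2 : 0 < e / 2 by rewrite divr_gt0.
have /cvgrPdist_le/(_ _ e2) := sw; apply: filterS => N.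
rewrite sub0r normrN => hN.
have -> : limn (series (fun n => u n * l n)) - limn (series (fun n => u n * s N n))
   = limn (series (w N)).
  rewrite -lim_seriesB; [|exact: abs_summable_cvg|exact: abs_summable_cvg].
  by congr (limn (series _)); apply/funext => n; rewrite /w mulrBr.
rewrite -[limn _](subrK (series (w N) K)).
rewrite (le_trans (ler_normD _ _))// (splitr e) lerD//.
apply: le_trans (hK (w N) (2 * M) _ (wu N)) _; first by rewrite mulr_ge0.
rewrite mulrA ler_pdivrMr// [leLHS]mulrC -mulrA ler_wpM2l ?(ltW e0)//.
by rewrite mulrA; lra.
Qed.

End abs_summable.

Lemma series_0 (R : realType) (w : R^nat) : series w 0%N = 0.
Proof. by rewrite /series/= big_geq. Qed.

Lemma series_eventually0 (R : realType) (w : R^nat) N :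
  (forall n, (N <= n)%N -> w n = 0) -> series w @ \oo --> series w N.
Proof.
move=> w0; apply: cvg_near_cst; near=> n.
have Nn : (N <= n)%N by near: n; exact: nbhs_infty_ge.
apply/eqP; rewrite -subr_eq0 sub_series Nn big_nat_cond big1// => i.
by rewrite andbT => /andP[/w0].
Unshelve. all: by end_near. Qed.

(** * Cauchy products *)

Definition conv (R : realType) (a b : R^nat) : R^nat :=
  fun n => \sum_(i < n.+1) a i * b (n - i)%N.

Section Cauchy_product.
Variable R : realType.
Implicit Types a b : R^nat.

(** Summing over the triangle $i+j<N$ by columns leaves partial sums of [b] as multipliers of [a i],
    the shape to which [tannery] applies. *)
Lemma series_conv a b N :
  series (conv a b) N = \sum_(i < N) a i * series b (N - i)%N.
Proof.
elim: N => [|N IH]; first by rewrite series_0 big_ord0.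
rewrite seriesSr IH /conv.
have -> : \sum_(i < N) a i * series b (N - i)%N =
    \sum_(i < N.+1) a i * series b (N - i)%N.
  by rewrite big_ord_recr/= subnn series_0 mulr0 addr0.
rewrite -big_split/=; apply: eq_bigr => i _.
have iN : (i <= N)%N by rewrite -ltnS.
by rewrite (subSn iN) seriesSr mulrDr.
Qed.

(* Mertens' theorem as a case of Tannery's: [series b (N - n)] is [0] for [N <= n]
   because the subtraction is truncated. *)
Lemma cvg_series_conv a b : abs_summable a -> abs_summable b ->
  series (conv a b) @ \oo --> limn (series a) * limn (series b).
Proof.
move=> sa sb; set M := limn (series (fun n => `|b n|)).
have := @tannery _ a (fun N i => series b (N - i)%N) (fun=> limn (series b)) M sa.
have h : limn (series (fun n => a n * series b (N - n)%N)) @[N --> \oo] =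
    series (conv a b) @ \oo.
  congr (_ @ \oo); apply/funext => N; rewrite series_conv.
  have w0 : forall n, (N <= n)%N -> a n * series b (N - n)%N = 0.
    by move=> n; rewrite -subn_eq0 => /eqP ->; rewrite series_0 mulr0.
  rewrite (cvg_lim _ (series_eventually0 w0))//.
  by rewrite /series/= big_mkord.
have -> : limn (series (fun n => a n * limn (series b))) =
    limn (series a) * limn (series b).
  rewrite mulrC; transitivity (limn (series (limn (series b) *: a))).
    by congr (limn (series _)); apply/funext => n; rewrite /= mulrC.
  exact: lim_seriesZ (abs_summable_cvg sa).
rewrite h; apply.
- by move=> N n; exact: series_norm_le.
- move=> n; rewrite (cvg_centern n (series b)); exact: abs_summable_cvg.
Qed.

(** The triangle inequality bounds the terms by the Cauchy product of the absolute values, whose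
    series converges by Mertens. *)
Lemma abs_summable_conv a b : abs_summable a -> abs_summable b ->
  abs_summable (conv a b).
Proof.
move=> sa sb.
have := cvg_series_conv (abs_summable_norm sa) (abs_summable_norm sb).
move=> /cvgP; apply: series_le_cvg => n; first exact: normr_ge0.
  by apply: sumr_ge0 => i _; rewrite mulr_ge0.
by apply: le_trans (ler_norm_sum _ _ _) _; apply: ler_sum => i _; rewrite normrM.
Qed.

Lemma lim_series_conv a b : abs_summable a -> abs_summable b ->
  limn (series (conv a b)) = limn (series a) * limn (series b).
Proof. by move=> sa sb; apply/cvg_lim => //; exact: cvg_series_conv. Qed.

Lemma convMX a b (z : R) n :
  conv a b n * z ^+ n = conv (fun n => a n * z ^+ n) (fun n => b n * z ^+ n) n.
Proof.
rewrite /conv mulr_suml; apply: eq_bigr => i _.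
by rewrite mulrACA -exprD subnKC// -ltnS.
Qed.

End Cauchy_product.

(** * The binomial series *)

Section binomial_series.
Variable R : realType.

(** The coefficient of $z^n$ in $(1-z)^{-a}$, that is $a(a+1)\cdots(a+n-1)/n!$. *)
Definition nbinom (a : R) (n : nat) : R := gbinom (a + n%:R - 1) n.

(** Together with [nbinom0], this recurrence is all that is used about the coefficients from here
    on. *)
Lemma nbinomS a n : nbinom a n.+1 * n.+1%:R = nbinom a n * (a + n%:R).
Proof.
rewrite /nbinom /gbinom big_ord_recl/= subr0.
have -> : \prod_(i < n) (a + n.+1%:R - 1 - (bump 0 i)%:R) =
   \prod_(i < n) (a + n%:R - 1 - i%:R).
  by apply: eq_bigr => i _; rewrite /bump/= add1n -!natr1; ring.
rewrite factS natrM -natr1.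
set p := \prod_(i < n) _.
have f0 : (n`!%:R : R) != 0 by rewrite pnatr_eq0 -lt0n fact_gt0.
have n0 : (n%:R + 1 : R) != 0 by rewrite natr1 pnatr_eq0.
by field; rewrite f0 n0.
Qed.

Lemma nbinom0 a : nbinom a 0 = 1.
Proof. by rewrite /nbinom /gbinom big_ord0 fact0 divr1. Qed.

Lemma abs_summable_geometric (q : R) : 0 <= q < 1 -> abs_summable (fun n => q ^+ n).
Proof.
move=> /andP[q0 q1]; rewrite /abs_summable.
have -> : (fun n => `|q ^+ n|) = geometric 1 q.
  by apply/funext => n/=; rewrite mul1r ger0_norm// exprn_ge0.
by apply: is_cvg_geometric_series; rewrite ger0_norm.
Qed.

Lemma abs_summable_ratio (u : R^nat) (q : R) N : 0 < q -> q < 1 ->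
  (forall n, (N <= n)%N -> `|u n.+1| <= q * `|u n|) -> abs_summable u.
Proof.
(* The sum of the first ratios dominates each of them, which settles the indices up to [N] at
   once. *)
move=> q0 q1 uq; pose C := \sum_(k < N.+1) `|u k| / q ^+ k.
have qn n : 0 < q ^+ n by exact: exprn_gt0.
have hC n : `|u n| <= C * q ^+ n.
  have small m : (m <= N)%N -> `|u m| <= C * q ^+ m.
    move=> mN; rewrite -ler_pdivrMr// /C.
    rewrite (bigD1 (Ordinal (mN : m < N.+1)%N))//= lerDl sumr_ge0// => i _.
    by rewrite divr_ge0// ltW.
  have [/small//|/ltnW/subnKC <-] := leqP n N.
  elim: (n - N)%N => [|k IH]; first by rewrite addn0; exact: small.
  rewrite addnS (le_trans (uq _ _)) ?leq_addr// exprS mulrCA.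
  by rewrite ler_wpM2l// ltW.
apply: (@abs_summable_le _ (fun n => q ^+ n) _ C).
  by move=> n; rewrite [`|q ^+ n|]gtr0_norm.
by apply: abs_summable_geometric; rewrite ltW.
Qed.

Lemma nbinom_ge0 a n : 0 < a -> 0 <= nbinom a n.
Proof.
move=> a0; elim: n => [|n IH]; first by rewrite nbinom0.
have n0 : 0 < n.+1%:R :> R by [].
by rewrite -(pmulr_lge0 _ n0) nbinomS mulr_ge0// addr_ge0// ltW.
Qed.

(** Ratio test: consecutive terms have ratio $|z|(a+n)/(n+1)$, which tends to $|z|<1$. *)
Lemma abs_summable_nbinom a (z : R) : 0 < a -> `|z| < 1 ->
  abs_summable (fun n => nbinom a n * z ^+ n).
Proof.
move=> a0 z1.
have [q /andP[zq q1]] : exists q, `|z| < q < 1 by exists ((`|z| + 1) / 2); lra.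
have q0 : 0 < q by exact: le_lt_trans zq.
(* From this index on $a\le(q-|z|)n$, whence $(a+n)|z|\le a+n|z|\le qn\le q(n+1)$. *)
have [N hN] : exists N : nat, a / (q - `|z|) <= N%:R.
  by exists (Num.bound (a / (q - `|z|))); apply/ltW/archi_boundP; rewrite divr_ge0 ?subr_ge0 ?ltW.
apply: (@abs_summable_ratio _ q N) => // n Nn.
have n0 : 0 < n.+1%:R :> R by [].
have nb m : `|nbinom a m| = nbinom a m by rewrite ger0_norm// nbinom_ge0.
rewrite -(ler_pM2r n0) exprS (normrM (nbinom a n.+1)) (normrM (nbinom a n)) (normrM z) !nb.
have -> : nbinom a n.+1 * (`|z| * `|z ^+ n|) * n.+1%:R =
    (nbinom a n * `|z ^+ n|) * ((a + n%:R) * `|z|).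
  rewrite [LHS]mulrAC nbinomS; ring.
rewrite [leRHS](_ : _ = nbinom a n * `|z ^+ n| * (q * n.+1%:R)); last by ring.
have P0 : 0 <= nbinom a n * `|z ^+ n|.
  by apply: mulr_ge0 => //; exact: nbinom_ge0.
rewrite ler_wpM2l//.
have : a <= (q - `|z|) * n%:R.
  rewrite mulrC -ler_pdivrMr ?subr_gt0//; apply: le_trans hN _.
  by rewrite ler_nat.
rewrite -natr1 => h.
have z0 : 0 <= `|z| by [].
have n'0 : 0 <= n%:R :> R by [].
have : a * `|z| <= a by rewrite ler_piMr// ltW.
set x := n%:R in h n'0 *; nra.
Qed.

(** With [nbinomS], the coefficient form of $\frac{d}{dz}(1-z)^{-a}=a(1-z)^{-a-1}$. *)
Lemma nbinomDl a n : a * nbinom (a + 1) n = (a + n%:R) * nbinom a n.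
Proof.
elim: n => [|n IH]; first by rewrite !nbinom0 addr0.
have n0 : (n.+1%:R : R) != 0 by rewrite pnatr_eq0.
apply: (mulIf n0); rewrite -mulrA nbinomS mulrA IH -[RHS]mulrA nbinomS -natr1.
by ring.
Qed.

(** The coefficient form of $(1-z)\,(1-z)^{-a-1}=(1-z)^{-a}$. *)
Lemma nbinom_pascal a n : 0 < a ->
  nbinom (a + 1) n.+1 = nbinom (a + 1) n + nbinom a n.+1.
Proof.
move=> a0; apply: (mulfI (lt0r_neq0 a0)); rewrite mulrDr !nbinomDl.
have := nbinomS a n; rewrite -natr1; set x := nbinom a n.+1; set y := nbinom a n.
by move=> h; apply/eqP; rewrite -subr_eq0 -(subrr (x * (n%:R + 1))) {2}h; apply/eqP; ring.
Qed.

Let f a (z : R) := limn (pseries (nbinom a) z).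

Let cvg_f a z : 0 < a -> `|z| < 1 -> cvgn (pseries (nbinom a) z).
Proof. by move=> a0 z1; apply: abs_summable_cvg; exact: abs_summable_nbinom. Qed.

Let fS a z : 0 < a -> `|z| < 1 -> (1 - z) * f (a + 1) z = f a z.
Proof.
move=> a0 z1; have a1 : 0 < a + 1 by rewrite addr_gt0.
have h N : pseries (nbinom a) z N.+1 =
    pseries (nbinom (a + 1)) z N.+1 - z * pseries (nbinom (a + 1)) z N.
  have pS c n : pseries c z n.+1 = pseries c z n + c n * z ^+ n.
    by rewrite /pseries seriesSr.
  have p0 c : pseries c z 0 = 0 by rewrite /pseries series_0.
  elim: N => [|N IH].
    by rewrite !pS !p0 mulr0 subr0 !nbinom0.
  rewrite (pS (nbinom a)) IH !(pS (nbinom (a + 1))) (nbinom_pascal N a0) exprS.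
  ring.
have c1 := @cvg_f _ z a1 z1.
rewrite mulrBl mul1r; apply/esym/cvg_lim => //.
rewrite -cvg_shiftS/=; under eq_fun do rewrite h.
apply: cvgB; first by rewrite (cvg_shiftS (pseries (nbinom (a + 1)) z)).
by apply: cvgM; [exact: cvg_cst|].
Qed.

Let diffs_nbinom a : pseries_diffs (nbinom a) = a *: nbinom (a + 1).
Proof.
by apply/funext => n; rewrite /pseries_diffs/= mulrC nbinomS mulrC -nbinomDl.
Qed.

Let pseriesZ (k : R) c z : pseries (k *: c) z = k *: pseries c z.
Proof.
apply/funext => n; rewrite /pseries/series/= [RHS]mulr_sumr.
by apply: eq_bigr => i _; rewrite mulrA.
Qed.

(** Termwise differentiation at a point inside the radius [K < 1]; the first and second derived
    series are again binomial series, with parameters [a + 1] and [a + 1 + 1]. *)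
Let is_derive_f (a z : R) : 0 < a -> `|z| < 1 -> is_derive z (1 : R) (f a) (a * f (a + 1) z).
Proof.
move=> a0 z1; have a1 : 0 < a + 1 by rewrite addr_gt0.
have a2 : 0 < a + 1 + 1 by rewrite addr_gt0.
have [K /andP[zK K1]] : exists K, `|z| < K < 1 by exists ((`|z| + 1) / 2); lra.
have nK : `|K| < 1 by rewrite gtr0_norm// (le_lt_trans _ zK).
have -> : a * f (a + 1) z = limn (pseries (pseries_diffs (nbinom a)) z).
  by rewrite diffs_nbinom pseriesZ limZl_tmp//; exact: cvg_f.
apply: (@pseries_snd_diffs _ _ K).
- exact: cvg_f.
- by rewrite diffs_nbinom pseriesZ; apply: is_cvgZl_tmp; exact: cvg_f.
- rewrite diffs_nbinom; have -> : pseries_diffs (a *: nbinom (a + 1)) =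
      a *: pseries_diffs (nbinom (a + 1)).
    by apply/funext => n; rewrite /pseries_diffs/= mulrCA.
  by rewrite diffs_nbinom scalerA pseriesZ; apply: is_cvgZl_tmp; exact: cvg_f.
- by rewrite (lt_le_trans zK)// ler_norm.
Qed.

(** The sum $f$ satisfies $(1-x)f'(x)=a f(x)$, so $g(x)=f(x)(1-x)^a$ has derivative zero on $]-1,1[$
    and equals $g(0)=1$. *)
Lemma binomial_series a (z : R) : 0 < a -> `|z| < 1 ->
  limn (series (fun n => nbinom a n * z ^+ n)) = (1 - z) `^ (- a).
Proof.
move=> a0 z1; rewrite -/(pseries _ _) -/(f a z).
pose g x := f a x * expR (a * ln (1 - x)).
have dg (x : R) : `|x| < 1 -> is_derive x (1 : R) g 0.
  move=> x1; have x0 : 0 < 1 - x by move: x1; rewrite ltr_norml; lra.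
  have df := is_derive_f a0 x1.
  have dl : is_derive x (1 : R) (expR \o ( *%R a \o (@ln R \o (fun y => 1 - y))))
      (expR (a * ln (1 - x)) * (a * ((1 - x)^-1 * - 1))).
    apply: is_derive1_comp; apply: is_derive1_comp.
      by apply: is_derive_eq; rewrite /GRing.scale/= mulr1.
    apply: is_derive1_comp; first exact: is_derive1_ln.
    by apply: is_derive_eq; rewrite add0r mul1r.
  have dfl := is_deriveM df dl.
  apply: (@is_derive_eq _ _ _ g x 1 _ _ dfl).
  rewrite /GRing.scale/= -(fS a0 x1); field.
  by rewrite gt_eqF.
have cg x y : `|x| < 1 -> `|y| < 1 -> {within `[x, y], continuous g}.
  rewrite !ltr_norml => /andP[x1 x2] /andP[y1 y2].
  apply: derivable_within_continuous => w; rewrite in_itv/= => /andP[xw wy].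
  have w1 : `|w| < 1 by rewrite ltr_norml (lt_le_trans x1)//= (le_lt_trans wy).
  by have [] := dg w w1.
have gxy x y : `|x| < 1 -> `|y| < 1 -> x < y -> g x = g y.
  move=> x1 y1 xy; have [|c _] := @MVT _ g (fun=> 0) x y xy _ (cg x y x1 y1).
    move: x1 y1; rewrite !ltr_norml => /andP[x1 x2] /andP[y1 y2].
    move=> w; rewrite in_itv/= => /andP[xw wy].
    by apply: dg; rewrite ltr_norml (lt_trans x1)//= (lt_trans wy).
  by rewrite mul0r => /eqP; rewrite subr_eq0 => /eqP.
have gz : g z = g 0.
  have n0 : `|0 : R| < 1 by rewrite normr0.
  by have [/gxy -> //|/gxy -> //|->] := ltgtP z 0.
have g0 : g 0 = 1.
  rewrite /g subr0 ln1 mulr0 expR0 mulr1 /f.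
  have w0 n : (1 <= n)%N -> nbinom a n * 0 ^+ n = 0.
    by case: n => // n _; rewrite expr0n mulr0.
  rewrite (cvg_lim _ (series_eventually0 w0))//.
  by rewrite /series/= big_nat1 nbinom0 expr0 mulr1.
have z0 : 0 < 1 - z by move: z1; rewrite ltr_norml; lra.
move: gz; rewrite g0 /g /powR (gt_eqF z0) mulNr expRN => gz.
have e0 : expR (a * ln (1 - z)) != 0 by rewrite gt_eqF// expR_gt0.
by apply: (mulIf e0); rewrite gz mulVf.
Qed.

End binomial_series.

(** * The polar integral *)

Section complex_limits.
Local Open Scope complex_scope.
Variable R : realType.

Lemma cvg_complex (x y : R^nat) (a b : R) : x @ \oo --> a -> y @ \oo --> b ->
  ((fun n => (x n +i* y n)%C) : nat -> R[i]^o) @ \oo --> ((a +i* b)%C : R[i]^o).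
Proof.
(* The radius is itself a complex number; being positive, it has imaginary part zero and is a real
   [e]. *)
move=> xa yb; apply/(@cvgrPdist_lt R[i] R[i]^o) => -[e e'] /=.
rewrite ltcE/= => /andP[/eqP -> e0].
have e2 : 0 < e / 2 by rewrite divr_gt0.
near=> n.
have h1 : `|a - x n| < e / 2 by near: n; move/cvgrPdist_lt : xa; exact.
have h2 : `|b - y n| < e / 2 by near: n; move/cvgrPdist_lt : yb; exact.
rewrite normc_def/= ltcE/= eqxx/=.
apply: (@le_lt_trans _ _ (`|a - x n| + `|b - y n|)); last by rewrite (splitr e) ltrD.
rewrite -(@ler_pXn2r _ 2%N)// ?nnegrE ?sqrtr_ge0 ?addr_ge0// sqr_sqrtr; last first.
  by rewrite addr_ge0 ?sqr_ge0.
rewrite -[(a - x n) ^+ 2]real_normK ?num_real// -[(b - y n) ^+ 2]real_normK ?num_real//.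
by rewrite sqrrD lerD2r lerDl mulrn_wge0// mulr_ge0.
Unshelve. all: by end_near. Qed.

Lemma complex_seriesE (u : nat -> R[i]) :
  cvgn (series (fun n => complex.Re (u n))) ->
  cvgn (series (fun n => complex.Im (u n))) ->
  complex_series u = (limn (series (fun n => complex.Re (u n)))
                   +i* limn (series (fun n => complex.Im (u n))))%C.
Proof.
move=> cr ci; apply/(@cvg_lim R[i]^o); first exact: (@norm_hausdorff R[i] R[i]^o).
have -> : (series u : nat -> R[i]^o) =
    (fun n => (series (fun n => complex.Re (u n)) n
           +i* series (fun n => complex.Im (u n)) n)%C).
  apply/funext; elim=> [|n IH]; first by rewrite /series/= !big_geq.
  rewrite !seriesSr IH; case: (u n) => a b /=.
  by rewrite /GRing.add/=.
exact: cvg_complex.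
Qed.

Lemma cisD (a b : R) : cis (a + b) = cis a * cis b.
Proof.
apply/eqP; rewrite eq_complex /cis cosD sinD /= eqxx/=.
by apply/eqP; rewrite addrC.
Qed.

Lemma cis_X (a : R) n : cis a ^+ n = cis (n%:R * a).
Proof.
elim: n => [|n IH]; first by rewrite expr0 mul0r /cis cos0 sin0.
by rewrite exprS IH -cisD -natr1 mulrDl mul1r addrC.
Qed.

Lemma Re_mulC (x : R) (z : R[i]) : complex.Re (x%:C * z) = x * complex.Re z.
Proof. by case: z => a b; simpc. Qed.

Lemma Im_mulC (x : R) (z : R[i]) : complex.Im (x%:C * z) = x * complex.Im z.
Proof. by case: z => a b; simpc. Qed.

Lemma Re_mul (z w : R[i]) :
  complex.Re (z * w) = complex.Re z * complex.Re w - complex.Im z * complex.Im w.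
Proof. by case: z => a b; case: w => c d; simpc. Qed.

Lemma Im_mul (z w : R[i]) :
  complex.Im (z * w) = complex.Re z * complex.Im w + complex.Im z * complex.Re w.
Proof. by case: z => a b; case: w => c d; simpc; rewrite [a * d + _]addrC. Qed.

(** The common form of [pow1B] and [gamma_cdf2] on circles: the modulus of the argument is absorbed
    into the coefficients [u]. *)
Definition fourier_series (u : R^nat) (t : R) : R[i] :=
  complex_series (fun n => (u n)%:C * cis t ^+ n).

Lemma fourier_seriesE u t : abs_summable u ->
  fourier_series u t = (limn (series (fun n => u n * cos (n%:R * t)))
                     +i* limn (series (fun n => u n * sin (n%:R * t))))%C.
Proof.
move=> su.
have er : (fun n => complex.Re ((u n)%:C * cis t ^+ n)) = fun n => u n * cos (n%:R * t).
  by apply/funext => n; rewrite Re_mulC cis_X.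
have ei : (fun n => complex.Im ((u n)%:C * cis t ^+ n)) = fun n => u n * sin (n%:R * t).
  by apply/funext => n; rewrite Im_mulC cis_X.
rewrite /fourier_series complex_seriesE ?er ?ei//.
- apply: abs_summable_cvg; apply: (@abs_summable_le _ u _ 1) => // n.
  by rewrite normrM mul1r ler_piMr// cos_max.
- apply: abs_summable_cvg; apply: (@abs_summable_le _ u _ 1) => // n.
  by rewrite normrM mul1r ler_piMr// sin_max.
Qed.

End complex_limits.

Section integral_series.
Context d (T : measurableType d) (R : realType).
Variables (mu : {measure set T -> \bar R}) (D : set T).
Hypotheses (mD : measurable D) (fD : (mu D < +oo)%E).

Lemma bounded_integrable (f : T -> R) (M : R) : measurable_fun D f ->
  (forall x, D x -> `|f x| <= M) -> mu.-integrable D (EFin \o f).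
Proof.
move=> mf fM; apply: (@le_integrable _ _ _ mu D mD _ (EFin \o cst M)).
- exact/measurable_EFinP.
- by move=> x Dx /=; rewrite lee_fin (le_trans (fM x Dx))// ler_norm.
- apply/integrableP; split; first exact/measurable_EFinP.
  by rewrite /= (integral_cst mu mD `|M|%:E) lte_mul_pinfty.
Qed.

(** Dominated convergence: all partial sums are bounded by the constant [M * U], integrable because
    the measure of [D] is finite. *)
Lemma cvg_Rintegral_series (u : R^nat) (h : nat -> T -> R) (M : R) :
  abs_summable u -> (forall n, measurable_fun D (h n)) ->
  (forall n x, D x -> `|h n x| <= M) ->
  series (fun n => u n * \int[mu]_(x in D) h n x) @ \oo -->
  \int[mu]_(x in D) limn (series (fun n => u n * h n x)).
Proof.
move=> su mh hM; set U := limn (series (fun n => `|u n|)).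
pose f N x := series (fun n => u n * h n x) N.
have sh x : D x -> abs_summable (fun n => u n * h n x).
  move=> Dx; apply: (abs_summable_le (M := M)) su => n.
  by rewrite normrM mulrC ler_wpM2r// hM.
have ih n : mu.-integrable D (EFin \o h n).
  exact: bounded_integrable (mh n) (hM n).
have mf N : measurable_fun D (f N).
  by apply: measurable_sum => n; apply: measurable_funM => //; exact: mh.
have fM N x : D x -> `|f N x| <= M * U.
  move=> Dx; have M0 : 0 <= M by exact: le_trans (hM 0%N x Dx).
  apply: le_trans (series_norm_le N (sh x Dx)) _.
  have <- : limn (series (M *: (fun n => `|u n|))) = M * U by exact: lim_seriesZ.
  apply: ler_lim; [exact: sh| exact: (is_cvg_seriesZ (k := M) su)|].
  apply: nearW => n; apply: ler_sum => i _.
  by rewrite normrM mulrC ler_wpM2r// hM.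
have intf N : \int[mu]_(x in D) f N x =
    series (fun n => u n * \int[mu]_(x in D) h n x) N.
  elim: N => [|N IH].
    under eq_Rintegral do rewrite /f series_0.
    by rewrite series_0 Rintegral_cst// mul0r.
  rewrite seriesSr -IH -RintegralZl// -RintegralD//; last 2 first.
  - by apply: bounded_integrable => [|x Dx]; [exact: mf|exact: fM].
  - apply: (@bounded_integrable _ (`|u N| * M)) => [|x Dx].
      by apply: measurable_funM => //; exact: mh.
    by rewrite normrM ler_wpM2l// hM.
  by apply: eq_Rintegral => x _; rewrite /f seriesSr.
rewrite (_ : series _ = (fun N => \int[mu]_(x in D) f N x)); last exact/esym/funext.
have cf x : D x -> f ^~ x @ \oo --> limn (series (fun n => u n * h n x)).
  by move=> Dx; exact: abs_summable_cvg (sh x Dx).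
apply: fine_cvg; rewrite fineK; last first.
  apply: integrable_fin_num => //; apply: (@bounded_integrable _ (M * U)).
    exact: (measurable_fun_cvg mf cf).
  by move=> x Dx; apply: (cvgn_norm_le (cf x Dx)) => N; exact: fM.
apply: (@dominated_cvg _ _ _ mu D mD _ _ (EFin \o cst (M * U))) => //.
- by move=> n; exact/measurable_EFinP.
- by move=> x Dx; apply/cvg_EFin; [exact: nearW|exact: cf].
- exact: (@bounded_integrable _ (`|M * U|)).
Qed.

End integral_series.

(** * Fourier coefficients over a half period *)

Section fourier_coefficients.
Local Open Scope complex_scope.
Variable R : realType.
Implicit Types (F : R -> R[i]) (e u : R^nat).
Local Notation mu := (@lebesgue_measure R).

(** Imposed on both components, because the real part of a product involves the imaginary parts of
    the factors. *)
Definition bounded_measurable F : Prop :=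
  [/\ measurable_fun setT (fun t => complex.Re (F t)),
      measurable_fun setT (fun t => complex.Im (F t)) &
      exists M, forall t, `|complex.Re (F t)| <= M /\ `|complex.Im (F t)| <= M].

Definition mean (f : R -> R) : R := pi^-1 * \int[mu]_(t in `[0, pi]) f t.

Lemma bounded_measurable_cst z : bounded_measurable (fun=> z).
Proof.
split; [exact: measurable_cst|exact: measurable_cst|].
by exists (Num.max `|complex.Re z| `|complex.Im z|) => t; rewrite !le_max !lexx orbT.
Qed.

Lemma bounded_measurableM F G : bounded_measurable F -> bounded_measurable G ->
  bounded_measurable (fun t => F t * G t).
Proof.
move=> [rF iF [M hM]] [rG iG [N hN]]; split.
- rewrite (_ : (fun _ => _) = fun t => complex.Re (F t) * complex.Re (G t)
     - complex.Im (F t) * complex.Im (G t)).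
    by apply: measurable_funB; apply: measurable_funM.
  by apply/funext => t; rewrite Re_mul.
- rewrite (_ : (fun _ => _) = fun t => complex.Re (F t) * complex.Im (G t)
     + complex.Im (F t) * complex.Re (G t)).
    by apply: measurable_funD; apply: measurable_funM.
  by apply/funext => t; rewrite Im_mul.
- exists (M * N + M * N) => t; have [h1 h2] := hM t; have [h3 h4] := hN t.
  rewrite Re_mul Im_mul; split.
    by rewrite (le_trans (ler_normB _ _))// !normrM lerD// ler_pM.
  by rewrite (le_trans (ler_normD _ _))// !normrM lerD// ler_pM.
Qed.

Lemma bounded_measurable_cis (s : R) : bounded_measurable (fun t => cis (s * t)).
Proof.
split.
- by apply: (measurableT_comp (continuous_measurable_fun (@continuous_cos R))); exact: measurable_funM.
- by apply: (measurableT_comp (continuous_measurable_fun (@continuous_sin R))); exact: measurable_funM.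
- by exists 1 => t; rewrite cos_max sin_max.
Qed.

Lemma bounded_measurableX F n : bounded_measurable F ->
  bounded_measurable (fun t => F t ^+ n).
Proof.
move=> bF; elim: n => [|n IH]; first exact: bounded_measurable_cst.
rewrite (_ : (fun t => F t ^+ n.+1) = (fun t => F t * F t ^+ n)).
  exact: bounded_measurableM.
by apply/funext => t; rewrite exprS.
Qed.

Lemma bounded_measurable_fourier u (s : R) : abs_summable u ->
  bounded_measurable (fun t => fourier_series u (s * t)).
Proof.
move=> su.
have sg (g : R -> R) t : (forall x, `|g x| <= 1) ->
    abs_summable (fun n => u n * g (n%:R * (s * t))).
  move=> g1; apply: (abs_summable_le (M := 1)) su => n.
  by rewrite normrM mul1r ler_piMr.
have mg (g : R -> R) : (forall x, `|g x| <= 1) -> measurable_fun setT g ->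
    measurable_fun setT (fun t => limn (series (fun n => u n * g (n%:R * (s * t))))).
  move=> g1 mg; apply: (@measurable_fun_cvg _ _ _ setT
      (fun N t => series (fun n => u n * g (n%:R * (s * t))) N)).
    move=> N; apply: measurable_sum => n; apply: measurable_funM => //.
    apply: (measurableT_comp mg).
    by apply: measurable_funM => //; apply: measurable_funM.
  by move=> t _; exact: abs_summable_cvg (sg g t g1).
have bg (g : R -> R) t : (forall x, `|g x| <= 1) ->
    `|limn (series (fun n => u n * g (n%:R * (s * t))))| <=
    limn (series (fun n => `|u n|)).
  move=> g1; apply: le_trans (lim_series_norm (sg g t g1)) _.
  apply: ler_lim; [exact: (sg g t g1)|exact: su|apply: nearW => n].
  by apply: ler_sum => i _; rewrite /= normrM ler_piMr.
split.
- rewrite (_ : (fun _ => _) = fun t => limn (series (fun n => u n * cos (n%:R * (s * t))))).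
    exact: (mg _ (@cos_max R) (continuous_measurable_fun (@continuous_cos R))).
  by apply/funext => t; rewrite fourier_seriesE.
- rewrite (_ : (fun _ => _) = fun t => limn (series (fun n => u n * sin (n%:R * (s * t))))).
    exact: (mg _ (@sin_max R) (continuous_measurable_fun (@continuous_sin R))).
  by apply/funext => t; rewrite fourier_seriesE.
- exists (limn (series (fun n => `|u n|))) => t; rewrite fourier_seriesE//=; split.
    by apply: bg; exact: cos_max.
  by apply: bg; exact: sin_max.
Qed.

Lemma Re_mul_fourier z u t : abs_summable u ->
  complex.Re (z * fourier_series u t) =
  limn (series (fun n => u n * complex.Re (z * cis t ^+ n))).
Proof.
move=> su; rewrite fourier_seriesE// Re_mul/=.
have sc : abs_summable (fun n => u n * cos (n%:R * t)).
  by apply: (abs_summable_le (M := 1)) su => n; rewrite normrM mul1r ler_piMr// cos_max.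
have ss : abs_summable (fun n => u n * sin (n%:R * t)).
  by apply: (abs_summable_le (M := 1)) su => n; rewrite normrM mul1r ler_piMr// sin_max.
apply/esym/cvg_lim => //.
rewrite (_ : series _ = (fun N => complex.Re z * series (fun n => u n * cos (n%:R * t)) N
   - complex.Im z * series (fun n => u n * sin (n%:R * t)) N)).
  apply: cvgB; apply: cvgM; [exact: cvg_cst|exact: abs_summable_cvg sc
                            |exact: cvg_cst|exact: abs_summable_cvg ss].
apply/funext => N; rewrite /series/= !mulr_sumr -sumrB; apply: eq_bigr => i _.
by rewrite cis_X Re_mul/=; ring.
Qed.

(** Integration term by term. The sign [s] allows both directions: [1] for powers of [cis t], [- 1]
    for powers of [cis (- t)]. *)
Lemma mean_fourier F u (s : R) : bounded_measurable F -> abs_summable u ->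
  mean (fun t => complex.Re (F t * fourier_series u (s * t))) =
  limn (series (fun n => u n * mean (fun t => complex.Re (F t * cis (s * t) ^+ n)))).
Proof.
move=> bF su.
have fpi : (mu [set` `[0%R, pi%R]] < +oo)%E.
  by rewrite lebesgue_measure_itv; case: ifP; rewrite ?ltry.
have [_ _ [M hM]] := bF.
have b n : bounded_measurable (fun t => F t * cis (s * t) ^+ n).
  by apply: bounded_measurableM => //; apply: bounded_measurableX; exact: bounded_measurable_cis.
rewrite /mean; under eq_Rintegral do rewrite Re_mul_fourier//.
have := @cvg_Rintegral_series _ _ _ mu _ _ fpi u
  (fun n t => complex.Re (F t * cis (s * t) ^+ n)) (M + M) su.
set w := (fun n => u n * \int[mu]_(x in _) _) => cw.
have {}cw : series w @ \oo --> \int[mu]_(t in [set` `[0%R, pi%R]])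
    limn (series (fun n => u n * complex.Re (F t * cis (s * t) ^+ n))).
  apply: cw => //.
    by move=> n; have [+ _ _] := b n; exact: measurable_funTS.
  move=> n t _; rewrite cis_X Re_mul/=; have [h1 h2] := hM t.
  rewrite (le_trans (ler_normB _ _))// !normrM lerD//.
    by rewrite (le_trans _ h1)// ler_piMr// cos_max.
  by rewrite (le_trans _ h2)// ler_piMr// sin_max.
rewrite -(cvg_lim _ cw)// -[LHS](@lim_seriesZ _ w pi^-1)//; last exact: cvgP cw.
 congr (limn (series _)).
by apply/funext => n; rewrite /w/= mulrCA.
Qed.

(** Integer frequencies make $\sin$ vanish at both ends of $[0,\pi]$. On a half period this
    orthogonality holds for cosines and not for sines, which is why real parts are taken before
    integrating. *)
Lemma mean_cos n l : mean (fun t : R => cos (n%:R * t - l%:R * t)) = (n == l)%:R.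
Proof.
have pi0 : 0 < pi :> R by exact: pi_gt0.
have npi0 : pi != 0 :> R by rewrite gt_eqF.
rewrite /mean; have [->|nl] := eqVneq n l.
  under eq_Rintegral do rewrite subrr cos0.
  have mpi : mu [set` `[0%R, pi%R]] = pi%:E.
    by rewrite lebesgue_measure_itv/= lte_fin pi0 oppr0 adde0.
  rewrite Rintegral_cst// (_ : fine _ = pi) ?mul1r ?mulVf//.
  by rewrite -[RHS]/(fine pi%:E) -mpi.
pose w : R := n%:R - l%:R.
have w0 : w != 0 by rewrite subr_eq0 eqr_nat.
pose F (t : R) := w^-1 * sin (w * t).
have dF (t : R) : is_derive t (1 : R) F (cos (w * t)).
  have dw : is_derive t (1 : R) (fun t => w * t) w.
    by apply: is_derive_eq; rewrite /GRing.scale/= mulr1.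
  have ds := is_derive1_comp (is_derive_sin (w * t)) dw.
  apply: (@is_derive_eq _ _ _ F t 1 _ _ (is_deriveZ w^-1 ds)).
  by rewrite /GRing.scale/= mulrCA mulVf// mulr1.
have cF : continuous F.
  by move=> t; apply: differentiable_continuous; apply/derivable1_diffP; case: (dF t).
have sinw : sin (w * pi) = 0.
  have sn (m : nat) : sin (m%:R * pi) = 0 :> R.
    elim: m => [|m IH]; first by rewrite mul0r sin0.
    by rewrite -natr1 mulrDl mul1r sinDpi IH oppr0.
  by rewrite mulrBl sinB !sn mul0r mulr0 subrr.
under eq_Rintegral do rewrite -mulrBl -/w.
rewrite /Rintegral (@continuous_FTC2 _ _ F 0 pi pi0).
- by rewrite /F sinw !mulr0 sin0 mulr0 sube0 mulr0.
- apply: continuous_subspaceT => t; apply: continuous_comp; last exact: continuous_cos.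
  by apply: cvgM; [exact: cvg_cst|exact: cvg_id].
- split.
  + by move=> t _; case: (dF t).
  + exact/cvg_at_right_filter/cF.
  + exact/cvg_at_left_filter/cF.
- by move=> t _; rewrite derive1E; have [_ ->] := dF t.
Qed.

(* [F t] is the sum of the [e n * cis (- t) ^+ n]; this is recorded through the
   real part of its integrals over a half period against [cis t ^+ n * cis (- t) ^+ l],
   a form that is stable under multiplication of [F] by a series in [cis (- t)]. *)
Definition has_coefs F e : Prop := [/\ bounded_measurable F, abs_summable e &
  forall n l, mean (fun t => complex.Re (F t * cis t ^+ n * cis (- t) ^+ l)) =
     if (l <= n)%N then e (n - l)%N else 0].

Definition conv1 : R^nat := fun n => (n == 0)%N%:R.

Lemma has_coefs1 : has_coefs (fun=> 1) conv1.
Proof.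
split; first exact: bounded_measurable_cst.
- apply/cvg_ex; exists (series (fun n => `|conv1 n|) 1); apply: series_eventually0 => n.
  by case: n => // n _; rewrite /conv1/= normr0.
- move=> n l;   rewrite (_ : (fun _ => _) = fun t => cos (n%:R * t - l%:R * t)).
    rewrite mean_cos /conv1; case: leqP => ln; last by rewrite ltn_eqF.
    by rewrite subn_eq0 eqn_leq ln andbT.
  by apply/funext => t; rewrite mul1r !cis_X -cisD/= mulrN.
Qed.

(** Expanding the new factor termwise, its [i]-th term raises [l] to [l + i]; the terms with
    [l + i > n] vanish, and what remains is the finite sum defining [conv u e (n - l)]. *)
Lemma has_coefsM F e u : abs_summable u -> has_coefs F e ->
  has_coefs (fun t => fourier_series u (- t) * F t) (conv u e).
Proof.
move=> su [bF se hF]; split.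
- apply: bounded_measurableM => //.
  rewrite (_ : (fun _ => _) = fun t => fourier_series u (- 1 * t)).
    exact: bounded_measurable_fourier.
  by apply/funext => t; rewrite mulN1r.
- exact: abs_summable_conv.
move=> n l; pose G t := F t * cis t ^+ n * cis (- t) ^+ l.
have bG : bounded_measurable G.
  apply: bounded_measurableM; first apply: bounded_measurableM => //.
    rewrite (_ : (fun _ => _) = fun t => cis (1 * t) ^+ n).
      by apply: bounded_measurableX; exact: bounded_measurable_cis.
    by apply/funext => t; rewrite mul1r.
  rewrite (_ : (fun _ => _) = fun t => cis (- 1 * t) ^+ l).
    by apply: bounded_measurableX; exact: bounded_measurable_cis.
  by apply/funext => t; rewrite mulN1r.
rewrite (_ : (fun _ => _) = fun t => complex.Re (G t * fourier_series u (- 1 * t))); last first.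
  by apply/funext => t; congr complex.Re; rewrite mulN1r /G; ring.
rewrite mean_fourier//.
have h i : mean (fun t => complex.Re (G t * cis (- 1 * t) ^+ i)) =
   if (l + i <= n)%N then e (n - (l + i))%N else 0.
  rewrite -hF; congr mean; apply/funext => t; congr complex.Re.
  by rewrite mulN1r /G exprD; ring.
under eq_fun do rewrite h.
have w0 i : ((n - l).+1 <= i)%N ->
    u i * (if (l + i <= n)%N then e (n - (l + i))%N else 0) = 0.
  move=> ni; rewrite ifF ?mulr0//; apply/negbTE; rewrite -ltnNge.
  by rewrite -(ltn_add2l l) in ni; apply: leq_ltn_trans ni; rewrite -leq_subLR.
rewrite (cvg_lim _ (series_eventually0 w0))//.
rewrite /series/= big_mkord; case: leqP => ln.
  rewrite /conv; apply: eq_bigr => i _.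
  have il : (i <= n - l)%N by rewrite -ltnS.
  by rewrite subnDA -(leq_subRL _ ln) il.
rewrite big1// => i _; rewrite ifF ?mulr0//; apply/negbTE; rewrite -ltnNge.
by rewrite ltn_addr.
Qed.

(** Parseval's identity for a series in [cis (- t)] against one in [cis t]; it uses the case [l = 0]
    of the coefficient property. *)
Lemma mean_has_coefs F e g : has_coefs F e -> abs_summable g ->
  mean (fun t => complex.Re (F t * fourier_series g t)) =
  limn (series (fun n => g n * e n)).
Proof.
move=> [bF se hF] sg.
rewrite (_ : (fun _ => _) = fun t => complex.Re (F t * fourier_series g (1 * t))); last first.
  by apply/funext => t; rewrite mul1r.
rewrite mean_fourier//; congr (limn (series _)); apply/funext => n.
have := hF n 0%N; rewrite leq0n subn0 => <-.
congr (_ * mean _); apply/funext => t.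
by rewrite mul1r expr0 mulr1.
Qed.

End fourier_coefficients.

Section real_complex.
Local Open Scope complex_scope.

Lemma real_complexMX (R : realType) (x y : R) n :
  (x * y ^+ n)%:C = x%:C * y%:C ^+ n.
Proof. by rewrite (rmorphM (real_complex R)) (rmorphXn (real_complex R)). Qed.

End real_complex.

Section polar_coefficients.
Local Open Scope complex_scope.
Variables (R : realType) (k : nat) (a c : 'I_k -> R) (r : R).
Hypotheses (a0 : forall j, 0 < a j) (r0 : 0 < r) (r1 : r < 1)
  (cr : forall j, `|c j| < r).

(* The Taylor coefficients of [prod_j (1 - c_j z / r)^(- a_j)]. *)
Definition polar_coef : R^nat :=
  \big[@conv R/@conv1 R]_(j < k) (fun n => nbinom (a j) n * (c j / r) ^+ n).

Let summable_factor j : abs_summable (fun n => nbinom (a j) n * (c j / r) ^+ n).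
Proof.
apply: abs_summable_nbinom => //.
by rewrite normrM normfV (gtr0_norm r0) ltr_pdivrMr// mul1r.
Qed.

Lemma has_coefs_polar : has_coefs
  (fun t => \prod_(j < k) pow1B (a j) ((c j / r)%:C * cis (- t))) polar_coef.
Proof.
pose W j t : R[i] := pow1B (a j) ((c j / r)%:C * cis (- t)).
rewrite -[X in has_coefs X]/(fun t => \prod_(j < k) W j t).
(* Written as an iterated product of functions, the left side runs in parallel with the iterated
   [conv] defining [polar_coef]. *)
have -> : (fun t => \prod_(j < k) W j t) =
    \big[(fun f g t => f t * g t)/(fun=> 1)]_(j < k) W j.
  by apply/funext => t; elim/big_rec2: _ => // j x f _ ->.
rewrite /polar_coef; elim/big_rec2: _ => [|j f e _ fe]; first exact: has_coefs1.
have -> : W j = fun t => fourier_series (fun n => nbinom (a j) n * (c j / r) ^+ n) (- t).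
  apply/funext => t; rewrite /W /pow1B /fourier_series; congr complex_series.
  by apply/funext => n; rewrite exprMn mulrA -real_complexMX.
exact: has_coefsM.
Qed.

Lemma abs_summable_polar_coef : abs_summable polar_coef.
Proof. by have [] := has_coefs_polar. Qed.

(** A product of binomial series, in which the radius cancels: $(c_j/r)(rz)=c_jz$. *)
Lemma series_polar_coef (z : R) : 0 <= z <= 1 ->
  limn (series (fun n => polar_coef n * (r * z) ^+ n)) =
  \prod_(j < k) (1 - c j * z) `^ (- a j).
Proof.
move=> /andP[z0 z1]; have rz0 : 0 <= r * z by rewrite mulr_ge0// ltW.
have rz1 : r * z <= 1 by rewrite (le_trans _ (ltW r1))// ler_piMr// ltW.
have sum_rz (u : R^nat) : abs_summable u -> abs_summable (fun n => u n * (r * z) ^+ n).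
  apply: (@abs_summable_le _ _ _ 1) => n.
  by rewrite normrM mul1r ler_piMr// normrX ger0_norm// exprn_ile1.
(* Summability of each partial product accompanies its value, since the next Cauchy product requires
   it. *)
suff [] : abs_summable polar_coef /\
  limn (series (fun n => polar_coef n * (r * z) ^+ n)) =
  \prod_(j < k) (1 - c j * z) `^ (- a j) by [].
rewrite /polar_coef; elim/big_rec2: _ => [|j p e _ [se <-]].
  have [_ s1 _] := @has_coefs1 R; split => //.
  have w0 n : (1 <= n)%N -> @conv1 R n * (r * z) ^+ n = 0.
    by case: n => // n _; rewrite mul0r.
  by rewrite (cvg_lim _ (series_eventually0 w0))// /series/= big_nat1 mul1r.
split; first exact: abs_summable_conv.
under eq_fun do rewrite convMX.
rewrite lim_series_conv//; [|exact: sum_rz|exact: sum_rz]; congr (_ * _).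
rewrite -binomial_series//; last first.
  rewrite normrM (ger0_norm z0) (le_lt_trans _ (lt_trans (cr j) r1))//.
  by rewrite ler_piMr.
congr (limn (series _)); apply/funext => n.
by rewrite -mulrA -exprMn mulrA divfK ?gt_eqF.
Qed.

End polar_coefficients.

Section polar_integral.
Local Open Scope complex_scope.

Lemma polar_integralE (R : realType) (k : nat) (a lam : 'I_k -> R) (alpha r x : R) :
  (forall j, 0 < a j) -> 0 < r -> r < 1 -> (forall j, `|cpar lam j| < r) ->
  (forall n, `|gamma_cdf (alpha + n%:R) (vpar lam * x)| <= 1) ->
  polar_integral a lam alpha r x =
  limn (series (fun n => (polar_coef a (cpar lam) r n * r ^+ n)
     * gamma_cdf (alpha + n%:R) (vpar lam * x))).
Proof.
move=> a0 r0 r1 cr g1; rewrite /polar_integral.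
set g := fun n => gamma_cdf (alpha + n%:R) (vpar lam * x) * r ^+ n.
have sg : abs_summable g.
  apply: (@abs_summable_le _ (fun n => r ^+ n) _ 1).
    by move=> n; rewrite normrM ler_wpM2r.
  by apply: abs_summable_geometric; rewrite (ltW r0).
have hE t : gamma_cdf2 alpha (vpar lam * x) (r%:C * cis t) = fourier_series g t.
  rewrite /gamma_cdf2 /fourier_series; congr complex_series.
  by apply/funext => n; rewrite exprMn mulrA -real_complexMX.
under eq_Rintegral do rewrite hE.
rewrite -[LHS]/(mean _) (mean_has_coefs (has_coefs_polar a0 r0 cr))//.
by congr (limn (series _)); apply/funext => n; rewrite /g; ring.
Qed.

End polar_integral.

(** * Gamma distributions *)

Section gamma_integral.
Variable R : realType.
Local Notation mu := (@lebesgue_measure R).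

(** The image of Lebesgue measure under $x\mapsto cx$, multiplied by $c$, agrees with Lebesgue
    measure on half-open intervals, hence everywhere; the half-line is its own preimage. *)
Lemma ge0_integral_scale (c : R) (f : R -> \bar R) : 0 < c ->
  measurable_fun setT f -> (forall x, 0 <= f x)%E ->
  (\int[mu]_(x in `]0%R, +oo[) f (c * x)%R =
   (c^-1)%:E * \int[mu]_(x in `]0%R, +oo[) f x)%E.
Proof.
move=> c0 mf f0.
have mc : measurable_fun [set: R] ( *%R c : R -> measurableTypeR R).
  exact: measurable_funM.
have c0' : 0 <= c by exact: ltW.
have ci0 : 0 <= c^-1 by rewrite invr_ge0.
pose ci : {nonneg R} := NngNum ci0.
have h (A : set (measurableTypeR R)) : measurable A ->
    pushforward mu ( *%R c : R -> measurableTypeR R) A = (c^-1%:E * mu A)%E.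
  move=> mA.
  have := @lebesgue_measure_unique R (mscale (NngNum c0') (pushforward mu ( *%R c : R -> measurableTypeR R))).
  move=> /(_ mc) H; rewrite (H _ A mA); last first.
    move=> _ [[a b]] _ <-.
    pose J : set R := [set` `]a / c, b / c]].
    transitivity (c%:E * mu J)%E.
      rewrite /J !lebesgue_measure_itv/= !lte_fin ltr_pM2r ?invr_gt0//.
      case: ifPn => _; last by rewrite mule0.
      by rewrite -!EFinD -EFinM -mulNr -mulrDl mulrC divfK// gt_eqF.
    congr (_ * mu _)%E; apply/seteqP.
    by split => x; rewrite /J/= !in_itv/= ltr_pdivrMr// ler_pdivlMr// ![x * c]mulrC.
  rewrite /mscale/= muleA -EFinM mulVf ?gt_eqF// mul1e//.
have eqD : [set` `]0%R, +oo[] = ( *%R c : R -> measurableTypeR R) @^-1` [set` `]0%R, +oo[].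
  by apply/seteqP; split => x /=; rewrite !in_itv/= !andbT pmulr_rgt0.
rewrite [in LHS]eqD.
rewrite -(@ge0_integral_pushforward _ _ (measurableTypeR R) (measurableTypeR R) R _ mc mu [set` `]0%R, +oo[] f)//; last exact: measurable_funTS.
rewrite (eq_measure_integral (mscale ci mu))//=; last first.
  by move=> A mA _; rewrite h.
by rewrite ge0_integral_mscale//=; exact: measurable_funTS.
Qed.

Lemma measurable_gamma (a c : R) :
  measurable_fun setT (fun t : R => expR (- (c * t)) * t `^ (a - 1)).
Proof.
apply: measurable_funM; last exact: measurable_powR.
by apply: measurableT_comp => //; apply: measurableT_comp.
Qed.

(** The interval is exhausted by segments away from [0], on which the primitive $t^a/a$ bounds the
    integral by $1/a$. *)
Lemma integral_powR_lty (a : R) : 0 < a ->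
  (\int[mu]_(t in `]0%R, 1%R]) (t `^ (a - 1))%:E < +oo)%E.
Proof.
(* Starting the denominators at [2] keeps the left endpoint strictly below [1], as the fundamental
   theorem of calculus asks. *)
move=> a0; pose F n := [set` `[(n.+2%:R : R)^-1, 1]].
have FE : [set` `]0%R, 1%R]] = \bigcup_n F n.
  apply/seteqP; split => x /=; rewrite in_itv/=.
    move=> /andP[x0 x1]; exists (Num.bound x^-1) => //=.
    rewrite /F/= in_itv/= x1 andbT invf_ple ?posrE//.
    apply/ltW/(lt_trans (archi_boundP _)); first by rewrite invr_ge0 ltW.
    by rewrite ltr_nat.
  by move=> [n _]; rewrite /F/= in_itv/= => /andP[h ->]; rewrite (lt_le_trans _ h)// invr_gt0.
have mp : measurable_fun [set: R] (fun t => (t `^ (a - 1))%:E).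
  by apply/measurable_EFinP.
have h : (\int[mu]_(x in F i) (x `^ (a - 1))%:E)%E @[i --> \oo] -->
    (\int[mu]_(x in \bigcup_i F i) (x `^ (a - 1))%:E)%E.
  apply: ge0_nondecreasing_set_cvg_integral.
  - apply/nondecreasing_seqP => n; rewrite subsetEset => x; rewrite /F/= !in_itv/=.
    move=> /andP[nx ->]; rewrite andbT (le_trans _ nx)// lef_pV2 ?posrE//.
    by rewrite ler_nat.
  - by move=> i; exact: measurable_itv.
  - by move=> i; exact: measurable_funTS.
  - by move=> i x _; rewrite lee_fin powR_ge0.
rewrite FE; apply: (@le_lt_trans _ _ (a^-1)%:E); last exact: ltry.
rewrite -(cvg_lim _ h)//; apply: lime_le; first by apply/cvg_ex; eexists; exact: h.
apply: nearW => n; set e : R := n.+2%:R^-1.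
have e0 : 0 < e by rewrite invr_gt0.
have e1 : e < 1 by rewrite invf_lt1// ltr1n.
pose G (t : R) := a^-1 * t `^ a.
have dG (t : R) : 0 < t -> is_derive t (1 : R) G (t `^ (a - 1)).
  move=> t0; have dp := is_derive1_powR a t0.
  apply: (@is_derive_eq _ _ _ G t 1 _ _ (is_deriveZ a^-1 dp)).
  by rewrite /GRing.scale/= mulrA mulVf ?mul1r// gt_eqF.
have cG (t : R) : 0 < t -> G @ t --> G t.
  move=> t0; apply: differentiable_continuous; apply/derivable1_diffP.
  by case: (dG t t0).
rewrite (@continuous_FTC2 _ _ G e 1 e1).
- rewrite -EFinB lee_fin /G powR1 mulr1 lerBlDr lerDl mulr_ge0 ?powR_ge0//.
  by rewrite invr_ge0 ltW.
- apply: derivable_within_continuous => t; rewrite in_itv/= => /andP[et _].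
  have t0 := lt_le_trans e0 et.
  by have [] := is_derive1_powR (a - 1) t0.
- split.
  + by move=> t; rewrite in_itv/= => /andP[et _]; case: (dG t (lt_trans e0 et)).
  + exact/cvg_at_right_filter/cG.
  + by apply/cvg_at_left_filter/cG.
- move=> t; rewrite in_itv/= => /andP[et _].
  by rewrite derive1E; have [_ ->] := dG t (lt_trans e0 et).
Qed.

Lemma powR_le_expR (a : R) : exists C, forall t, 1 <= t ->
  t `^ (a - 1) <= C * expR (t / 2).
Proof.
(* The exponent $m+1$ exceeds $a-1$, and the term of that degree in the exponential series gives
   $(t/2)^{m+1}/(m+1)!\le e^{t/2}$. *)
pose m := Num.bound (`|a - 1|); exists (2 ^+ m.+1 * (m.+1)`!%:R) => t t1.
have t0 : 0 <= t by exact: le_trans t1.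
apply: (@le_trans _ _ (t `^ m.+1%:R)).
  apply: ler_powR => //; apply: le_trans (ler_norm _) _.
  by apply/ltW/(lt_le_trans (archi_boundP _)) => //; rewrite ler_nat.
rewrite powR_mulrn//.
have := expR_ge1Dxn m (_ : 0 <= t / 2); rewrite divr_ge0// => /(_ isT) h.
have f0 : 0 < (m.+1)`!%:R :> R by rewrite ltr0n fact_gt0.
have : (t / 2) ^+ m.+1 / (m.+1)`!%:R <= expR (t / 2) by apply: le_trans h; rewrite lerDr.
rewrite ler_pdivrMr// exprMn exprVn ler_pdivrMr ?exprn_gt0// => /le_trans; apply.
by rewrite [leLHS](_ : _ = 2 ^+ m.+1 * (m.+1)`!%:R * expR (t / 2))//; ring.
Qed.

(** The integrand is twice the exponential density of rate $1/2$. *)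
Lemma integral_expR_half : (\int[mu]_(t in `]1%R, +oo[) (expR (- (t / 2)))%:E < +oo)%E.
Proof.
have h0 : 0 < 2^-1 :> R by rewrite invr_gt0.
have h := integral_exponential_pdf h0.
apply: (@le_lt_trans _ _ (\int[mu]_t (2%:E * (exponential_pdf 2^-1 t)%:E))%E).
  rewrite integral_mkcond; apply: ge0_le_integral => //.
  - by move=> x _; apply: erestrict_ge0 => t _; rewrite lee_fin expR_ge0.
  - have m1 : measurable_fun ([set` `]1%R, +oo[] : set R) (fun t : R => (expR (- (t / 2)))%:E).
      apply: measurable_funTS; apply/measurable_EFinP; apply: measurableT_comp => //.
      by apply: measurableT_comp => //; exact: measurable_funM.
    have mD : measurable ([set` `]1%R, +oo[] : set R) by exact: measurable_itv.
    exact: ((measurable_restrictT _ mD).1 m1).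
  - apply/measurable_EFinP; apply: measurable_funM => //.
    by apply: measurable_exponential_pdf; exact: ltW.
  - move=> x _; rewrite /patch; case: ifPn => [|_].
      rewrite inE/= in_itv/= andbT => x1; rewrite exponential_pdfE; last first.
        by rewrite (le_trans _ (ltW x1)).
      by rewrite -EFinM lee_fin mulrA divff// mul1r mulNr mulrC.
    by rewrite mule_ge0// lee_fin exponential_pdf_ge0// ltW.
rewrite ge0_integralZl//; first by rewrite h mule1 ltry.
- apply/measurable_EFinP; apply: measurable_exponential_pdf; exact: ltW.
- by move=> x _; rewrite lee_fin exponential_pdf_ge0// ltW.
Qed.

(** Extended-valued, so that finiteness can be proved; the real integral [gamma_fun] would be [0] if
    this were infinite. *)
Definition gamma_integral (a c : R) : \bar R :=
  (\int[mu]_(t in `]0%R, +oo[) (expR (- (c * t)) * t `^ (a - 1))%:E)%E.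

(** The two difficulties are separated at [1]: the singularity of $t^{a-1}$ below, and above it the
    growth of $t^{a-1}$, absorbed by half of the exponential decay. *)
Lemma gamma_integral_lty a : 0 < a -> (gamma_integral a 1 < +oo)%E.
Proof.
move=> a0; rewrite /gamma_integral.
have -> : [set` `]0%R, +oo[] = [set` `]0%R, 1%R]] `|` [set` `]1%R, +oo[] :> set R.
  by apply: itv_bndbnd_setU; rewrite bnd_simp.
have mg := measurable_gamma a 1.
rewrite ge0_integral_setU//=; last 3 first.
- by apply/measurable_EFinP; exact: measurable_funTS.
- by move=> x _; rewrite lee_fin mulr_ge0 ?expR_ge0 ?powR_ge0.
- by apply/disj_setPS => x [/=]; rewrite !in_itv/= => /andP[_ x1]; rewrite andbT ltNge x1.
apply: lte_add_pinfty.
  apply: le_lt_trans (integral_powR_lty a0); apply: ge0_le_integral => //.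
  - by move=> x _; rewrite lee_fin mulr_ge0 ?expR_ge0 ?powR_ge0.
  - by apply/measurable_EFinP; exact: measurable_funTS.
  - by apply/measurable_EFinP; apply: measurable_funTS; exact: measurable_powR.
  - move=> x/=; rewrite in_itv/= => /andP[x0 x1].
    by rewrite lee_fin mul1r ler_piMl ?powR_ge0// expR_le1 oppr_le0 ltW.
have [C hC] := powR_le_expR a.
have C0 : 0 <= C.
  have := le_trans (powR_ge0 _ _) (hC 1 (lexx _)).
  by rewrite pmulr_lge0// expR_gt0.
apply: (@le_lt_trans _ _ (\int[mu]_(t in `]1%R, +oo[) (C%:E * (expR (- (t / 2)))%:E))%E).
  apply: ge0_le_integral => //.
  - by move=> x _; rewrite lee_fin mulr_ge0 ?expR_ge0 ?powR_ge0.
  - by apply/measurable_EFinP; exact: measurable_funTS.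
  - apply/measurable_EFinP; apply: measurable_funM => //; apply: measurable_funTS.
    by apply: measurableT_comp => //; apply: measurableT_comp => //; exact: measurable_funM.
  - move=> x/=; rewrite in_itv/= andbT => x1.
    rewrite lee_fin mul1r mulrC; apply: le_trans (ler_wpM2r (expR_ge0 _) (hC x (ltW x1))) _.
    by rewrite -mulrA -expRD ler_wpM2l// ler_expR; lra.
rewrite ge0_integralZl//.
- by rewrite lte_mul_pinfty//; exact: integral_expR_half.
- apply/measurable_EFinP; apply: measurable_funTS.
  by apply: measurableT_comp => //; apply: measurableT_comp => //; exact: measurable_funM.
Qed.

Lemma gamma_integral_gt0 a : 0 < a -> (0 < gamma_integral a 1)%E.
Proof.
move=> a0; have mg := measurable_gamma a 1.
(* On $]1,2]$ one has $e^{-t}\ge e^{-2}$ and, as $a>0$, $t^{a-1}\ge t^{-1}\ge 1/2$. *)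
have c0 : 0 < expR (- 2) * 2^-1 :> R by rewrite mulr_gt0 ?expR_gt0 ?invr_gt0.
apply: (@lt_le_trans _ _ (\int[mu]_(t in `]1%R, 2%R]) (expR (- 2) * 2^-1)%:E)%E).
  rewrite integral_cst//= lebesgue_measure_itv/= lte_fin ltr1n -EFinB -EFinM lte_fin.
  by rewrite mulr_gt0// subr_gt0 ltr1n.
apply: (@le_trans _ _ (\int[mu]_(t in `]1%R, 2%R]) (expR (- (1 * t)) * t `^ (a - 1))%:E)%E).
  apply: ge0_le_integral.
  - exact: measurable_itv.
  - by move=> x _; rewrite lee_fin ltW.
  - exact: measurable_cst.
  - by apply/measurable_EFinP; exact: measurable_funTS.
  - move=> x/=; rewrite in_itv/= => /andP[x1 x2]; rewrite lee_fin mul1r.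
    have x0 : 0 < x by exact: lt_trans x1.
    apply: ler_pM; [exact: expR_ge0|by rewrite invr_ge0| by rewrite ler_expR lerN2|].
    apply: (@le_trans _ _ (x `^ (-1))).
      by rewrite powR_inv1 ?(ltW x0)// lef_pV2 ?posrE.
    by apply: ler_powR; [exact: ltW|rewrite lerDr ltW].
apply: ge0_subset_integral => //.
- by apply/measurable_EFinP; exact: measurable_funTS.
- by move=> x _; rewrite lee_fin mulr_ge0 ?expR_ge0 ?powR_ge0.
- by move=> x/=; rewrite !in_itv/= => /andP[x1 _]; rewrite andbT (lt_trans _ x1).
Qed.

Lemma gamma_integral_scale a c : 0 < c ->
  gamma_integral a c = ((c `^ (- a))%:E * gamma_integral a 1)%E.
Proof.
move=> c0; rewrite /gamma_integral; have mg := measurable_gamma a 1.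
have := @ge0_integral_scale c (fun t => (expR (- (1 * t)) * t `^ (a - 1))%:E) c0.
have h : (\int[mu]_(t in `]0%R, +oo[) (expR (- (1 * (c * t))) * (c * t) `^ (a - 1))%:E =
   (c `^ (a - 1))%:E * gamma_integral a c)%E.
  rewrite -ge0_integralZl//.
  - apply: eq_integral => t; rewrite inE/= in_itv/= andbT => t0.
    by rewrite -EFinM mul1r powRM ?ltW// mulrCA.
  - by apply/measurable_EFinP; apply: measurable_funTS; exact: measurable_gamma.
  - by move=> x _; rewrite lee_fin mulr_ge0 ?expR_ge0 ?powR_ge0.
  - by rewrite lee_fin powR_ge0.
rewrite h -/(gamma_integral a 1) -/(gamma_integral a c) => H.
have cn : c != 0 by rewrite gt_eqF.
have e1 : c `^ (- a) = c `^ (1 - a) * c^-1.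
  by rewrite -powR_inv1 ?(ltW c0)// -powRD ?cn ?implybT//; congr (_ `^ _); ring.
rewrite e1 EFinM -muleA -H; last 2 first.
- by apply/measurable_EFinP.
- by move=> x; rewrite lee_fin mulr_ge0 ?expR_ge0 ?powR_ge0.
rewrite muleA -EFinM -powRD ?cn ?implybT//.
by rewrite (_ : 1 - a + (a - 1) = 0) ?powRr0 ?mul1e//; ring.
Qed.

Lemma gamma_funE (a : R) : 0 < a -> (gamma_fun a)%:E = gamma_integral a 1.
Proof.
move=> a0; rewrite /gamma_fun /Rintegral.
have -> : (\int[mu]_(t in `]0%R, +oo[) (expR (- t) * t `^ (a - 1))%:E)%E = gamma_integral a 1.
  by apply: eq_integral => t _; rewrite mul1r.
by rewrite fineK// ge0_fin_numE ?gamma_integral_lty// ltW// gamma_integral_gt0.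
Qed.

Lemma gamma_fun_gt0 (a : R) : 0 < a -> 0 < gamma_fun a.
Proof. by move=> a0; rewrite -lte_fin gamma_funE// gamma_integral_gt0. Qed.

Lemma gamma_pdf_ge0 (a t : R) : 0 < a -> 0 <= gamma_pdf a t.
Proof.
move=> a0; rewrite /gamma_pdf divr_ge0 ?mulr_ge0 ?expR_ge0 ?powR_ge0//.
exact/ltW/gamma_fun_gt0.
Qed.

Lemma measurable_gamma_pdf (a : R) : measurable_fun setT (gamma_pdf a).
Proof.
apply: measurable_funM => //.
rewrite (_ : (fun t => _) = fun t => expR (- (1 * t)) * t `^ (a - 1)).
  exact: measurable_gamma.
by apply/funext => t; rewrite mul1r.
Qed.

Lemma integral_gamma_pdf_expR (a s : R) : 0 < a -> 0 <= s ->
  (\int[mu]_(t in `]0%R, +oo[) (gamma_pdf a t * expR (- (s * t)))%:E =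
   ((1 + s) `^ (- a))%:E)%E.
Proof.
move=> a0 s0; have s1 : 0 < 1 + s by rewrite ltr_pwDl.
have g0 := gamma_fun_gt0 a0.
transitivity (\int[mu]_(t in `]0%R, +oo[)
    (((gamma_fun a)^-1)%:E * (expR (- ((1 + s) * t)) * t `^ (a - 1))%:E))%E.
  apply: eq_integral => t _; rewrite -EFinM /gamma_pdf; congr EFin.
  by rewrite mulrDl mul1r opprD expRD; ring.
rewrite ge0_integralZl//.
- rewrite -/(gamma_integral a (1 + s)) gamma_integral_scale// -gamma_funE//.
  by rewrite -!EFinM mulrCA mulVf ?mulr1// gt_eqF.
- by apply/measurable_EFinP; apply: measurable_funTS; exact: measurable_gamma.
- by move=> x _; rewrite lee_fin mulr_ge0 ?expR_ge0 ?powR_ge0.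
- by rewrite lee_fin invr_ge0 ltW.
Qed.

Lemma integral_gamma_pdf (a : R) : 0 < a ->
  (\int[mu]_(t in `]0%R, +oo[) (gamma_pdf a t)%:E = 1)%E.
Proof.
move=> a0; transitivity (((1 + 0) `^ (- a))%:E : \bar R).
  rewrite -integral_gamma_pdf_expR//; apply: eq_integral => t _.
  by rewrite mul0r oppr0 expR0 mulr1.
by rewrite addr0 powR1.
Qed.

Lemma integrable_gamma_pdf (a : R) : 0 < a ->
  mu.-integrable [set` `]0%R, +oo[] (EFin \o gamma_pdf a).
Proof.
move=> a0; apply/integrableP; split.
  by apply/measurable_EFinP; apply: measurable_funTS; exact: measurable_gamma_pdf.
apply: (@le_lt_trans _ _ (\int[mu]_(t in `]0%R, +oo[) (gamma_pdf a t)%:E)%E).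
  rewrite le_eqVlt; apply/orP; left; apply/eqP; apply: eq_integral => t _.
  by rewrite /= ger0_norm// gamma_pdf_ge0.
by rewrite integral_gamma_pdf// ltry.
Qed.

(** The cutoff moves into the integrand, so that all integrals live on one domain, as in the
    inversion formula. *)
Lemma gamma_cdfE (a x : R) : 0 < a ->
  gamma_cdf a x = \int[mu]_(t in `]0, +oo[) (gamma_pdf a t * ((t : R) <= x)%R%:R).
Proof.
move=> a0; rewrite /gamma_cdf.
have -> : [set` `]0, x]] = [set` `]0, +oo[] `&` [set t : R | t <= x].
  by apply/seteqP; split => t /=; rewrite !in_itv/= andbT; [move=> /andP[]|case=> -> ->].
rewrite Rintegral_mkcondr; apply: eq_Rintegral => t _; rewrite patchE.
case: ifPn; first by rewrite inE/= => ->; rewrite mulr1.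
by rewrite notin_setE/= => /negP/negbTE ->; rewrite mulr0.
Qed.

Lemma integrable_gamma_pdf_le (a x : R) : 0 < a -> mu.-integrable [set` `]0%R, +oo[]
  (EFin \o fun t => gamma_pdf a t * ((t : R) <= x)%R%:R).
Proof.
move=> a0; have mle : measurable_fun setT (fun t : R => (t <= x)%R%:R : R).
  rewrite (_ : (fun _ => _) = \1_[set` `]-oo, x]]).
    by apply: measurable_indic; exact: measurable_itv.
  by apply/funext => t; rewrite indicE mem_setE in_itv.
have ig := integrable_gamma_pdf a0.
apply: (@le_integrable _ _ _ mu _ (measurable_itv _) _ (EFin \o gamma_pdf a)) => //.
  apply/measurable_EFinP; apply: measurable_funTS; apply: measurable_funM => //.
  exact: measurable_gamma_pdf.
move=> t _ /=; rewrite lee_fin normrM ler_piMr// ger0_norm//.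
by case: (t <= x)%R.
Qed.

Lemma gamma_cdf_itv01 (a x : R) : 0 < a -> 0 <= gamma_cdf a x <= 1.
Proof.
move=> a0; rewrite gamma_cdfE//; apply/andP; split.
  by apply: Rintegral_ge0 => t _; rewrite mulr_ge0// gamma_pdf_ge0.
rewrite [leRHS](_ : _ = \int[mu]_(t in `]0, +oo[) gamma_pdf a t); last first.
  by rewrite /Rintegral integral_gamma_pdf.
apply: le_Rintegral => //.
- exact: integrable_gamma_pdf_le.
- exact: integrable_gamma_pdf.
- by move=> t _; rewrite ler_piMr ?gamma_pdf_ge0//; case: (t <= x)%R.
Qed.

(** The inversion kernel tends to the indicator of $x<y$ and so recovers tails rather than
    distribution functions. *)
Lemma gamma_ccdfE (a x : R) : 0 < a ->
  \int[mu]_(t in `]0, +oo[) (gamma_pdf a t * (x < (t : R))%R%:R) = 1 - gamma_cdf a x.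
Proof.
move=> a0; rewrite gamma_cdfE//.
transitivity (\int[mu]_(t in `]0, +oo[) gamma_pdf a t -
    \int[mu]_(t in `]0, +oo[) (gamma_pdf a t * ((t : R) <= x)%R%:R)); last first.
  by congr (_ - _); rewrite /Rintegral integral_gamma_pdf.
rewrite -RintegralB//; last 2 first.
- exact: integrable_gamma_pdf.
- exact: integrable_gamma_pdf_le.
apply: eq_Rintegral => t _; rewrite real_ltNge ?num_real//.
by case: (t <= x)%R; rewrite ?mulr1 ?mulr0 ?subrr ?subr0.
Qed.

End gamma_integral.

(** * Inversion of the Laplace transform *)

Section laplace_inversion.
Variable R : realType.
Implicit Types x y : R.

(* (1 - e^(-ny))^N with N of order n e^(nx) is a polynomial in e^(-ny) and tends to
   the indicator of x < y at every y >= 0, including y = x, so that no continuity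
   of the distribution function is needed. *)
Definition laplace_exponent x (n : nat) : nat :=
  (Num.truncn (n%:R * expR (n%:R * x))).+1.

Definition laplace_kernel x n y : R :=
  (1 - expR (- (n%:R * y))) ^+ laplace_exponent x n.

Lemma laplace_kernel_itv01 x n y : 0 <= y -> 0 <= laplace_kernel x n y <= 1.
Proof.
move=> y0; have h0 : 0 <= 1 - expR (- (n%:R * y)).
  by rewrite subr_ge0 expR_le1 oppr_le0 mulr_ge0.
by rewrite exprn_ge0//= exprn_ile1// gerBl expR_ge0.
Qed.

Lemma bernoulli_exprn (u : R) n : 0 <= u <= 1 -> 1 - n%:R * u <= (1 - u) ^+ n.
Proof.
move=> /andP[u0 u1]; elim: n => [|n IH]; first by rewrite mul0r subr0.
rewrite exprS -natr1.
have n0 : 0 <= n%:R :> R by [].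
have := ler_wpM2l (_ : 0 <= 1 - u) IH; rewrite subr_ge0 => /(_ u1).
apply: le_trans; rewrite -subr_ge0.
have -> : (1 - u) * (1 - n%:R * u) - (1 - (n%:R + 1) * u) = n%:R * (u * u) by ring.
by rewrite !mulr_ge0.
Qed.

(* The [n.+1] are the coefficients of (1 - z)^(-2). *)
Lemma cvg_natSM_expR (d : R) : 0 < d -> (n.+1%:R * expR (- (n%:R * d))) @[n --> \oo] --> (0 : R).
Proof.
move=> d0; have e1 : `|expR (- d)| < 1 by rewrite ger0_norm ?expR_ge0// expR_lt1 oppr_lt0.
have := cvg_series_cvg_0 (abs_summable_cvg (@abs_summable_nbinom R 2 _ (ltr0Sn _ 1) e1)).
have nb n : nbinom (2 : R) n = n.+1%:R.
  elim: n => [|n IH]; first by rewrite nbinom0.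
  have n0 : (n.+1%:R : R) != 0 by rewrite pnatr_eq0.
  by apply: (mulIf n0); rewrite nbinomS IH -!natr1; ring.
apply: cvg_trans; apply: near_eq_cvg; apply: nearW => n.
by rewrite nb -expRM_natl mulrN.
Qed.

(** Let $N$ be the exponent, just above $ne^{nx}$. If $x<y$, Bernoulli's inequality bounds the
    kernel below by $1-Ne^{-ny}\ge 1-(n+1)e^{-n(y-x)}$. If $y\le x$, then $1-u\le e^{-u}$ bounds it
    above by $\exp(-Ne^{-ny})\le e^{-n}$, where the factor $n$ in $N$ takes care of $y=x$. *)
Lemma cvg_laplace_kernel x y : 0 <= x -> 0 <= y ->
  laplace_kernel x n y @[n --> \oo] --> ((x < y)%R%:R : R).
Proof.
move=> x0 y0; have u0 n : 0 <= expR (- (n%:R * y)) :> R by exact: expR_ge0.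
have u1 n : expR (- (n%:R * y)) <= 1 by rewrite expR_le1 oppr_le0 mulr_ge0.
have t0 n : 0 <= n%:R * expR (n%:R * x) by rewrite mulr_ge0 ?expR_ge0.
have [xy|yx] := ltP x y.
  have d0 : 0 < y - x by rewrite subr_gt0.
  apply: (@squeeze_cvgr _ _ _ _ (fun n => 1 - n.+1%:R * expR (- (n%:R * (y - x)))) (cst 1)).
  - apply: nearW => n; have /andP[_ ->] := laplace_kernel_itv01 x n y0; rewrite andbT.
    apply: le_trans (bernoulli_exprn _ _); last by rewrite u0 u1.
    rewrite lerD2l lerN2 /laplace_exponent -natr1 mulrDl -natr1 [leRHS]mulrDl lerD//.
      apply: (@le_trans _ _ (n%:R * expR (n%:R * x) * expR (- (n%:R * y)))).
        by rewrite ler_wpM2r// truncn_le.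
      by rewrite -mulrA -expRD ler_wpM2l// ler_expR; lra.
    rewrite !mul1r ler_expR lerN2 ler_wpM2l//; lra.
  - rewrite -[X in _ --> X]subr0; apply: cvgB; first exact: cvg_cst.
    exact: cvg_natSM_expR.
  - exact: cvg_cst.
apply: (@squeeze_cvgr _ _ _ _ (cst 0) (fun n => expR (- n%:R))).
- apply: nearW => n; have /andP[-> _] := laplace_kernel_itv01 x n y0 => /=.
  apply: (@le_trans _ _ (expR (- expR (- (n%:R * y))) ^+ laplace_exponent x n)).
    rewrite lerXn2r ?nnegrE ?expR_ge0 ?subr_ge0//.
    exact: expR_ge1Dx.
  rewrite -expRM_natl ler_expR mulrN lerN2.
  apply: (@le_trans _ _ (n%:R * expR (n%:R * x) * expR (- (n%:R * y)))).
    rewrite -mulrA -expRD ler_peMr// -expR0 ler_expR subr_ge0 ler_wpM2l//.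
  by rewrite ler_wpM2r// /laplace_exponent; apply/ltW; rewrite truncnS_gt.
- exact: cvg_cst.
- exact: cvgn_expR.
Qed.

(** The binomial expansion of the kernel with $e^{-niy}$ replaced by the value of [L] at [n * i]: a
    linear functional of [L], whatever [L] is the transform of. *)
Definition laplace_inverse x (L : nat -> R) (n : nat) : R :=
  \sum_(i < (laplace_exponent x n).+1)
    (- 1) ^+ i * 'C(laplace_exponent x n, i)%:R * L (n * i)%N.

Lemma laplace_kernelE x n y : laplace_kernel x n y =
  laplace_inverse x (fun m => expR (- (m%:R * y))) n.
Proof.
rewrite /laplace_kernel exprBn; apply: eq_bigr => i _.
rewrite expr1n mulr1 -mulr_natr mulrAC; congr (_ * _).
by rewrite -expRM_natr natrM; congr expR; ring.
Qed.

End laplace_inversion.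

Section laplace_inversion_integral.
Context d (T : measurableType d) (R : realType).
Variables (mu : {measure set T -> \bar R}) (D : set T) (f X : T -> R).
Hypotheses (mD : measurable D) (intf : mu.-integrable D (EFin \o f))
  (mX : measurable_fun D X)
  (f0 : forall t, D t -> 0 <= f t) (X0 : forall t, D t -> 0 <= X t).

(** Carrying both a weight and a variable covers a random variable under a probability (weight [1])
    and a rescaled gamma density. *)
Definition laplace_transform (m : nat) : R :=
  \int[mu]_(t in D) (f t * expR (- (m%:R * X t))).

Let mf : measurable_fun D f.
Proof. by apply/measurable_EFinP; case/integrableP: intf. Qed.

Let integrable_le (g : T -> R) : measurable_fun D g ->
  (forall t, D t -> `|g t| <= f t) -> mu.-integrable D (EFin \o g).
Proof.
move=> mg gf; apply: (@le_integrable _ _ _ mu D mD _ (EFin \o f)) => //.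
- exact/measurable_EFinP.
- by move=> t Dt /=; rewrite lee_fin (le_trans (gf t Dt))// ler_norm.
Qed.

Lemma Rintegral_sum (g : nat -> T -> R) n :
  (forall i, mu.-integrable D (EFin \o g i)) ->
  \int[mu]_(t in D) (\sum_(i < n) g i t) = \sum_(i < n) \int[mu]_(t in D) g i t.
Proof.
move=> ig; have isum m : mu.-integrable D (EFin \o fun t => \sum_(i < m) g i t).
  rewrite (_ : _ \o _ = (fun t => \sum_(i < m) (g i t)%:E)%E).
    by apply: integrable_sum => // i _; exact: ig.
  by apply/funext => t; rewrite /= sumEFin.
elim: n => [|n IH].
  under eq_Rintegral do rewrite big_ord0.
  by rewrite big_ord0 Rintegral_cst// mul0r.
rewrite big_ord_recr/= -IH -RintegralD//.
by apply: eq_Rintegral => t _; rewrite big_ord_recr.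
Qed.

Lemma integral_laplace_kernel x n :
  \int[mu]_(t in D) (f t * laplace_kernel x n (X t)) =
  laplace_inverse x laplace_transform n.
Proof.
rewrite /laplace_inverse /laplace_transform; set N := laplace_exponent x n.
pose g i t := (- 1) ^+ i * 'C(N, i)%:R * (f t * expR (- ((n * i)%:R * X t))).
have mg m : measurable_fun D (fun t => f t * expR (- (m%:R * X t))).
  apply: measurable_funM => //; apply: measurableT_comp => //.
  by apply: measurableT_comp => //; apply: measurable_funM.
have ie m : mu.-integrable D (EFin \o fun t => f t * expR (- (m%:R * X t))).
  apply: integrable_le => // t Dt; rewrite normrM ger0_norm ?f0//.
  rewrite ler_piMr ?f0// ger0_norm ?expR_ge0// expR_le1 oppr_le0.
  by rewrite mulr_ge0// X0.
have ig i : mu.-integrable D (EFin \o g i).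
  have h := integrableZl mD ((- 1) ^+ i * 'C(N, i)%:R) (ie (n * i)%N).
  by apply: (eq_integrable mD _ _ _ h) => t _; rewrite /= -EFinM.
transitivity (\int[mu]_(t in D) (\sum_(i < N.+1) g i t)).
  apply: eq_Rintegral => t _; rewrite laplace_kernelE /laplace_inverse mulr_sumr.
  by apply: eq_bigr => i _; rewrite /g mulrCA.
rewrite Rintegral_sum//; apply: eq_bigr => i _.
by rewrite /g RintegralZl.
Qed.

Let mlt x : measurable_fun D (fun t => (x < X t)%R%:R : R).
Proof.
have m1 : measurable_fun setT (fun y : R => (x < y)%R%:R : R).
  rewrite (_ : (fun _ => _) = \1_[set` `]x, +oo[]).
    by apply: measurable_indic; exact: measurable_itv.
  by apply/funext => t; rewrite indicE mem_setE in_itv/= andbT.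
exact: (measurableT_comp m1 mX).
Qed.

(** Dominated convergence under [f] itself, since the kernel takes values in $[0,1]$ where [X] is
    nonnegative. *)
Lemma cvg_laplace_inverse x : 0 <= x ->
  laplace_inverse x laplace_transform n @[n --> \oo] -->
  \int[mu]_(t in D) (f t * (x < X t)%R%:R).
Proof.
move=> x0; under eq_fun do rewrite -integral_laplace_kernel.
have mk n : measurable_fun D (fun t => f t * laplace_kernel x n (X t)).
  apply: measurable_funM => //; apply: measurable_funX => //.
  apply: measurable_funB => //; apply: measurableT_comp => //.
  by apply: measurableT_comp => //; apply: measurable_funM.
apply: fine_cvg; rewrite fineK; last first.
  apply: integrable_fin_num => //; apply: integrable_le; first exact: measurable_funM.
  move=> t Dt; rewrite normrM ger0_norm ?f0// ler_piMr ?f0//.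
  by rewrite ger0_norm//; case: (x < X t).
apply: (@dominated_cvg _ _ _ mu D mD _ _ (EFin \o f)) => //.
- by move=> n; exact/measurable_EFinP.
- move=> t Dt; apply/cvg_EFin; first exact: nearW.
  by apply: cvgM; [exact: cvg_cst|apply: cvg_laplace_kernel => //; exact: X0].
- move=> n t Dt /=; rewrite lee_fin normrM ger0_norm ?f0// ler_piMr ?f0//.
  by have /andP[k0 k1] := laplace_kernel_itv01 x n (X0 Dt); rewrite ger0_norm.
Qed.

(** The uniform bound with which [tannery] inverts the mixture term by term. *)
Lemma laplace_inverse_itv01 x n : (\int[mu]_(t in D) (f t)%:E = 1)%E ->
  0 <= laplace_inverse x laplace_transform n <= 1.
Proof.
move=> f1; rewrite -integral_laplace_kernel; apply/andP; split.
  apply: Rintegral_ge0 => t Dt; rewrite mulr_ge0 ?f0//.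
  by have /andP[] := laplace_kernel_itv01 x n (X0 Dt).
rewrite [leRHS](_ : _ = \int[mu]_(t in D) f t); last by rewrite /Rintegral f1.
have kf t : D t -> f t * laplace_kernel x n (X t) <= f t.
  by move=> Dt; rewrite ler_piMr ?f0//; have /andP[] := laplace_kernel_itv01 x n (X0 Dt).
apply: le_Rintegral => //; apply: integrable_le => [|t Dt].
  apply: measurable_funM => //; apply: measurable_funX => //.
  apply: measurable_funB => //; apply: measurableT_comp => //.
  by apply: measurableT_comp => //; apply: measurable_funM.
rewrite ger0_norm ?kf// mulr_ge0 ?f0//.
by have /andP[] := laplace_kernel_itv01 x n (X0 Dt).
Qed.

End laplace_inversion_integral.

(** * Distribution functions from signed gamma mixtures *)

Section gamma_mixture.
Variable R : realType.

Lemma limn_series_sum (n : nat) (c : nat -> R) (u : nat -> R^nat) :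
  (forall i, abs_summable (u i)) ->
  \sum_(i < n) c i * limn (series (u i)) =
  limn (series (fun m => \sum_(i < n) c i * u i m)).
Proof.
move=> su; apply/esym/cvg_lim => //.
rewrite (_ : series _ = fun N => \sum_(i < n) c i * series (u i) N).
  apply: (@cvg_big R _ +%R 0 xpredT _ _ _ _ (fun (i : 'I_n) N => c i * series (u i) N)) => [|i _].
    exact: add_continuous.
  by apply: cvgM; [exact: cvg_cst|exact: abs_summable_cvg].
apply/funext => N; rewrite /series/= exchange_big/=.
by apply: eq_bigr => i _; rewrite mulr_sumr.
Qed.

Lemma laplace_inverseZ (K x : R) (L : nat -> R) N :
  laplace_inverse x (fun m => K * L m) N = K * laplace_inverse x L N.
Proof.
by rewrite /laplace_inverse mulr_sumr; apply: eq_bigr => i _; rewrite mulrCA.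
Qed.

Lemma laplace_inverse_series (x : R) (g : R^nat) (L : nat -> nat -> R) N :
  (forall m, abs_summable (fun n => g n * L n m)) ->
  laplace_inverse x (fun m => limn (series (fun n => g n * L n m))) N =
  limn (series (fun n => g n * laplace_inverse x (L n) N)).
Proof.
move=> sg; rewrite /laplace_inverse; move: (laplace_exponent x N) => M.
pose c i : R := (- 1) ^+ i * 'C(M, i)%:R.
have h := @limn_series_sum M.+1 c (fun i n => g n * L n (N * i)%N) (fun i => sg (N * i)%N).
rewrite -[LHS]/(\sum_(i < M.+1) c i * _) h.
congr (limn (series _)); apply/funext => n; rewrite mulr_sumr.
by apply: eq_bigr => i _; rewrite mulrCA.
Qed.

Local Notation leb := (@lebesgue_measure R).

(** The law of [X] and the mixture have the same combinations [laplace_inverse] for every [N]. Their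
    limits are the tail of [X] and, by [tannery], the mixture of the tails $1-G_{\alpha+n}(vx)$;
    subtracting from the total masses gives the claim. *)
Lemma gamma_mixture_cdf d (T : measurableType d) (P : {measure set T -> \bar R})
    (D : set T) (X : T -> R) (g : R^nat) (K alpha v x : R) :
  measurable D -> (P D < +oo)%E -> measurable_fun D X ->
  (forall t, D t -> 0 <= X t) ->
  abs_summable g -> 0 < alpha -> 0 < v -> 0 <= x ->
  (forall m : nat, \int[P]_(t in D) expR (- (m%:R * X t)) =
     K * limn (series (fun n => g n * (1 + m%:R / v) `^ (- (alpha + n%:R))))) ->
  \int[P]_(t in D) (X t <= x)%R%:R =
  K * limn (series (fun n => g n * gamma_cdf (alpha + n%:R) (v * x))).
Proof.
move=> mD fD mX X0 sg a0 v0 x0 hL.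
pose Dp : set (measurableTypeR R) := [set` `]0, +oo[].
have mDp : measurable Dp by exact: measurable_itv.
have an0 n : 0 < alpha + n%:R by rewrite ltr_wpDr.
(* The transform of a gamma variable of shape [alpha + n] divided by [v]. *)
pose Lg n := @laplace_transform _ _ _ leb Dp (gamma_pdf (alpha + n%:R)) (fun t => t / v).
have LgE n m : Lg n m = (1 + m%:R / v) `^ (- (alpha + n%:R)).
  have mv0 : 0 <= m%:R / v by rewrite divr_ge0// ltW.
  rewrite -[RHS]/(fine (_ `^ _)%:E) -(integral_gamma_pdf_expR (an0 n) mv0).
  by congr fine; apply: eq_integral => t _; rewrite [m%:R / v * t]mulrAC mulrA.
have i1 : P.-integrable D (EFin \o (cst 1 : T -> R)).
  by apply: (@bounded_integrable _ _ _ P D mD fD _ 1) => // t _; rewrite normr1.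
pose LP := @laplace_transform _ _ _ P D (cst 1) X.
have LPE m : LP m = K * limn (series (fun n => g n * Lg n m)).
  rewrite /LP /laplace_transform -[LHS]/(\int[P]_(t in D) (1 * _)).
  under eq_Rintegral do rewrite mul1r.
  by rewrite hL; congr (_ * _); congr (limn (series _)); apply/funext => n; rewrite LgE.
have ip n := integrable_gamma_pdf (an0 n).
have p0 n t : Dp t -> 0 <= gamma_pdf (alpha + n%:R) t by move=> _; exact: gamma_pdf_ge0.
have tv0 t : Dp t -> 0 <= t / v.
  by rewrite /Dp/= in_itv/= andbT => t0; rewrite divr_ge0// ltW.
have mtv : measurable_fun Dp (fun t => t / v) by exact: measurable_funM.
have inv01 N n : `|laplace_inverse x (Lg n) N| <= 1.
  have := laplace_inverse_itv01 mDp (ip n) mtv (p0 n) tv0 x N (integral_gamma_pdf (an0 n)).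
  by move=> /andP[h0 h1]; rewrite ger0_norm.
have G1 n : \int[leb]_(t in Dp) (gamma_pdf (alpha + n%:R) t * (x < t / v)%R%:R) =
    1 - gamma_cdf (alpha + n%:R) (v * x).
  rewrite -gamma_ccdfE//; apply: eq_Rintegral => t _.
  by rewrite ltr_pdivlMr// [x * v]mulrC.
have sgG m : abs_summable (fun n => g n * Lg n m).
  apply: (@abs_summable_le _ g _ 1) => // n; rewrite mul1r normrM ler_piMr// LgE.
  rewrite ger0_norm ?powR_ge0//.
  apply: (@le_trans _ _ ((1 + m%:R / v) `^ 0)); last by rewrite powRr0.
  apply: ler_powR; first by rewrite lerDl divr_ge0// ltW.
  by rewrite oppr_le0; exact/ltW/an0.
have invE N : laplace_inverse x LP N =
    K * limn (series (fun n => g n * laplace_inverse x (Lg n) N)).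
  rewrite -laplace_inverse_series// -laplace_inverseZ.
  by congr (laplace_inverse x _ N); apply/funext.
have cvg1 := cvg_laplace_inverse mD i1 mX (fun _ _ => ler01) X0 x0.
have G01 n : `|gamma_cdf (alpha + n%:R) (v * x)| <= 1.
  by have /andP[h0 h1] := gamma_cdf_itv01 (v * x) (an0 n); rewrite ger0_norm.
have cvg2 : laplace_inverse x LP N @[N --> \oo] -->
    K * limn (series (fun n => g n * (1 - gamma_cdf (alpha + n%:R) (v * x)))).
  under eq_fun do rewrite invE.
  apply: cvgM; first exact: cvg_cst.
  apply: (@tannery _ g (fun N n => laplace_inverse x (Lg n) N) _ 1) => //.
  by move=> n; rewrite -G1; exact: (cvg_laplace_inverse mDp (ip n) mtv (p0 n) tv0 x0).
have h1 := cvg_unique (@Rhausdorff R) cvg1 cvg2.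
(* The transform at [0] identifies the total masses. *)
have h0 : \int[P]_(t in D) 1 = K * limn (series g).
  have := LPE 0%N; rewrite /LP /laplace_transform.
  under eq_Rintegral do rewrite mul0r oppr0 expR0 mulr1.
  move=> ->; congr (_ * _); congr (limn (series _)); apply/funext => n.
  by rewrite LgE mul0r addr0 powR1 mulr1.
have sG : abs_summable (fun n => g n * (1 - gamma_cdf (alpha + n%:R) (v * x))).
  apply: (@abs_summable_le _ g _ 2) => // n; rewrite normrM mulrC ler_wpM2r//.
  by rewrite (le_trans (ler_normB _ _))// normr1; have := G01 n; lra.
have -> : (fun n => g n * gamma_cdf (alpha + n%:R) (v * x)) =
    (g - (fun n => g n * (1 - gamma_cdf (alpha + n%:R) (v * x))))%R.
  by apply/funext => n; rewrite !fctE; ring.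
rewrite lim_seriesB; [|exact: abs_summable_cvg|exact: abs_summable_cvg].
transitivity (\int[P]_(t in D) 1 - \int[P]_(t in D) (cst 1 t * (x < X t)%R%:R)); last first.
  have E (A B : R) : K * A - K * B = K * (A - B) by rewrite mulrBr.
  by rewrite h0 h1; exact: E.
rewrite -RintegralB//.
  apply: eq_Rintegral => t _; rewrite /= mul1r real_ltNge ?num_real//.
  by case: (X t <= x)%R; rewrite ?subr0 ?subrr.
apply: (@bounded_integrable _ _ _ P D mD fD _ 1) => [|t _].
  apply: measurable_funM => //.
  have m1 : measurable_fun setT (fun y : R => (x < y)%R%:R : R).
    rewrite (_ : (fun _ => _) = \1_[set` `]x, +oo[]).
      by apply: measurable_indic; exact: measurable_itv.
    by apply/funext => t; rewrite indicE mem_setE in_itv/= andbT.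
  exact: (measurableT_comp m1 mX).
by rewrite /= mul1r ger0_norm//; case: (x < X t)%R.
Qed.

End gamma_mixture.

(** * The parameters $v$ and $c_j$ *)

Section scale_parameters.
Variables (R : realType) (k : nat) (lam : 'I_k -> R).
Hypothesis lam0 : forall j, 0 < lam j.

Lemma fmax_ge j : lam j <= fmax lam.
Proof. by rewrite /fmax; apply: (@le_bigmax _ R). Qed.

Lemma fmin_le j : fmin lam <= lam j.
Proof. by rewrite /fmin; apply: (@bigmin_le _ R). Qed.

Lemma fmin_gt0 (j : 'I_k) : 0 < fmin lam.
Proof.
rewrite /fmin; elim/big_ind: _ => //; last by move=> x y; rewrite lt_min => -> ->.
(* The starting value [head 0 (codom lam)] of the minimum must be positive too; the index [j] shows
   that the codomain is not empty, so its head is a value of [lam]. *)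
have : lam j \in codom lam by exact: codom_f.
have : all (fun y => 0 < y) (codom lam) by apply/allP => y /codomP[i ->].
by case: (codom lam) => //= y s /andP[].
Qed.

Lemma vpar_gt0 (j : 'I_k) : 0 < vpar lam.
Proof.
have m0 := fmin_gt0 j; have M0 := lt_le_trans m0 (le_trans (fmin_le j) (fmax_ge j)).
by rewrite /vpar mulr_gt0 ?invr_gt0// addr_gt0 ?invr_gt0.
Qed.

(** With $M$, $m$ the extreme values, $c_j=1-2Mm/((M+m)\lambda_j)$ increases with $\lambda_j$, and
    its values at $m$ and $M$ are $\mp(M-m)/(M+m)$. *)
Lemma cpar_norm_le j :
  `|cpar lam j| <= (fmax lam - fmin lam) / (fmax lam + fmin lam).
Proof.
have m0 := fmin_gt0 j; have lm := fmin_le j; have lM := fmax_ge j.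
have M0 := lt_le_trans m0 (le_trans lm lM).
rewrite /cpar /vpar.
set M := fmax lam in lM M0 *; set m := fmin lam in m0 lm *; set l := lam j in lm lM *.
have l0 : 0 < l := lt_le_trans m0 lm.
have Mm0 : 0 < M + m by rewrite addr_gt0.
have [ln Mn mn Sn] : [/\ l != 0, M != 0, m != 0 & M + m != 0] by rewrite !gt_eqF.
have Sn' : m + M != 0 by rewrite addrC.
have -> : 1 - (2^-1 * (M^-1 + m^-1) * l)^-1 = 1 - 2 * M * m / ((M + m) * l).
  by field; rewrite ?ln ?Mn ?mn ?Sn ?Sn'.
rewrite ler_norml; apply/andP; split.
  rewrite -subr_ge0; have -> : 1 - 2 * M * m / ((M + m) * l) - - ((M - m) / (M + m)) =
    2 * M * (l - m) / ((M + m) * l) by field; rewrite ?ln ?Mn ?mn ?Sn ?Sn'.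
  by rewrite divr_ge0 ?mulr_ge0 ?subr_ge0 ?(ltW M0) ?(ltW Mm0) ?(ltW l0).
rewrite -subr_ge0; have -> : (M - m) / (M + m) - (1 - 2 * M * m / ((M + m) * l)) =
    2 * m * (M - l) / ((M + m) * l) by field; rewrite ?ln ?Mn ?mn ?Sn ?Sn'.
by rewrite divr_ge0 ?mulr_ge0 ?subr_ge0 ?(ltW m0) ?(ltW Mm0) ?(ltW l0).
Qed.

End scale_parameters.

Lemma powR_sumN (R : realType) (k : nat) (a : 'I_k -> R) (x : R) : 0 < x ->
  x `^ (- \sum_(j < k) a j) = \prod_(j < k) x `^ (- a j).
Proof.
move=> x0; rewrite -sumrN; elim/big_rec2: _ => [|j p s _ <-]; first exact: powRr0.
by rewrite powRD// (gt_eqF x0) implybT.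
Qed.

(** The common core of both claims, which enter through the transform alone. The set [D] is there
    because a sum of gamma variables is known to be nonnegative only almost surely. *)
Lemma gamma_sum_cdf (R : realType) d (T : measurableType d)
    (P : {measure set T -> \bar R}) (D : set T) (X : T -> R)
    (k : nat) (a lam : 'I_k -> R) (r x : R) :
  (0 < k)%N -> (forall j, 0 < a j) -> (forall j, 0 < lam j) ->
  measurable D -> (P D < +oo)%E -> measurable_fun D X ->
  (forall t, D t -> 0 <= X t) ->
  (forall m : nat, \int[P]_(t in D) expR (- (m%:R * X t)) =
     \prod_(j < k) (1 + m%:R * lam j) `^ (- a j)) ->
  (fmax lam - fmin lam) / (fmax lam + fmin lam) < r -> r < 1 -> 0 <= x ->
  let alpha := \sum_(j < k) a j in
  \int[P]_(t in D) (X t <= x)%R%:R =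
  vpar lam `^ (- alpha) * (\prod_(j < k) lam j `^ (- a j))
    * polar_integral a lam alpha r x.
Proof.
move=> k0 a0 lam0 mD fD mX X0 hL hr r1 x0 alpha.
pose j0 := Ordinal k0; have v0 := vpar_gt0 lam0 j0; set v := vpar lam in v0 *.
have cr j : `|cpar lam j| < r by exact: le_lt_trans (cpar_norm_le lam0 j) hr.
have r0 : 0 < r by exact: le_lt_trans (cr j0).
have alpha0 : 0 < alpha.
  rewrite /alpha (bigD1 j0)//= ltr_pwDl// sumr_ge0// => i _; exact: ltW.
have an0 n : 0 < alpha + n%:R by rewrite ltr_wpDr.
set e := polar_coef a (cpar lam) r; pose g n := e n * r ^+ n.
have se : abs_summable e by exact: abs_summable_polar_coef.
have sg : abs_summable g.
  apply: (@abs_summable_le _ e _ 1) => // n.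
  rewrite mul1r normrM ler_piMr// normrX ger0_norm ?(ltW r0)// exprn_ile1 ?ltW//.
rewrite (gamma_mixture_cdf (g := g) (K := v `^ (- alpha) * \prod_(j < k) lam j `^ (- a j))
  (alpha := alpha) (v := v) mD fD mX X0)//.
  rewrite polar_integralE// => n.
  by have /andP[h0 h1] := gamma_cdf_itv01 (v * x) (an0 n); rewrite ger0_norm.
move=> m; rewrite hL; set s := 1 + m%:R / v.
have s1 : 1 <= s by rewrite lerDl divr_ge0// ltW.
have s0 : 0 < s by exact: lt_le_trans s1.
have z01 : 0 <= s^-1 <= 1 by rewrite invr_ge0 (ltW s0) invf_le1.
(* The series becomes the generating function of [polar_coef] at $r/s$, that is [series_polar_coef]
   at $z=1/s$. *)
have -> : (fun n => g n * s `^ (- (alpha + n%:R))) =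
    s `^ (- alpha) *: (fun n => e n * (r * s^-1) ^+ n).
  apply/funext => n; rewrite opprD powRD; last by rewrite (gt_eqF s0) implybT.
  rewrite powR_invn ?(ltW s0)// /g /GRing.scale/= exprMn exprVn mulrCA.
  by rewrite -[RHS]/(_ * _) !mulrA.
rewrite lim_seriesZ; last first.
  apply: abs_summable_cvg; apply: (@abs_summable_le _ e _ 1) => // n.
  have /andP[z0 z1] := z01.
  rewrite mul1r normrM ler_piMr// normrX exprn_ile1// ger0_norm ?mulr_ge0 ?(ltW r0)//.
  by rewrite (le_trans _ (ltW r1))// ler_piMr// ltW.
rewrite series_polar_coef// /GRing.scale/= -/alpha.
rewrite /alpha !powR_sumN// mulrA -!big_split/=; apply: eq_bigr => j _.
have l0 := lam0 j.
have cz : 0 <= 1 - cpar lam j * s^-1.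
  have /andP[z0 z1] := z01.
  rewrite subr_ge0 (le_trans (ler_norm _))// normrM (ger0_norm z0).
  by rewrite mulr_ile1// ltW// (lt_trans (cr j)).
have nn1 : 0 <= v * lam j by rewrite mulr_ge0 ?(ltW v0) ?(ltW l0).
have nn2 : 0 <= v * lam j * s by rewrite mulr_ge0 ?(ltW s0).
rewrite -(powRM _ (ltW v0) (ltW l0)) -(powRM _ nn1 (ltW s0)) -(powRM _ nn2 cz).
(* What is left is $v\lambda_j\,s\,(1-c_j/s)=1+m\lambda_j$. *)
congr (_ `^ _).
rewrite /cpar -/v /s; field.
by rewrite !gt_eqF// ltr_wpDr.
Qed.

(** * Independence and expectations *)

Section positive_functional.
Local Open Scope ereal_scope.
Context d (T : measurableType d) (R : realType).
Implicit Types (Phi Psi : (T -> \bar R) -> \bar R) (f g : T -> \bar R).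

(* The iterated integral [integral_tuple] is not an integral for a measure, hence
   this axiomatization of what the monotone class argument needs. *)
Definition positive_functional Phi : Prop :=
  [/\ forall f g, measurable_fun setT f -> (forall x, 0 <= f x) ->
        measurable_fun setT g -> (forall x, 0 <= g x) ->
        Phi (fun x => f x + g x) = Phi f + Phi g,
      forall (c : R) f, (0 <= c)%R -> measurable_fun setT f ->
        (forall x, 0 <= f x) -> Phi (fun x => c%:E * f x) = c%:E * Phi f &
      forall (f : nat -> T -> \bar R), (forall n, measurable_fun setT (f n)) ->
        (forall n x, 0 <= f n x) -> (forall x, nondecreasing_seq (f ^~ x)) ->
        Phi (fun x => limn (f ^~ x)) = limn (fun n => Phi (f n))].

Import HBNNSimple.

(** The list of values is chosen before [Phi], so that two functionals can be compared on the same
    decomposition. *)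
Lemma positive_functional_nnsfun (h : {nnsfun T >-> R}) :
  exists s : seq R, forall Phi, positive_functional Phi -> Phi (EFin \o h) =
    \sum_(y <- s) y%:E * Phi (fun x => (\1_(h @^-1` [set y]) x)%:E).
Proof.
have /finite_seqP[s0 hs0] : finite_set (range h) by exact: fimfunP.
pose s := undup s0.
have hs : range h = [set` s].
  by rewrite hs0; apply/seteqP; split=> y /=; rewrite mem_undup.
exists s => Phi [PhiD PhiZ _].
have m1 y : measurable_fun setT (fun x => (\1_(h @^-1` [set y]) x)%:E : \bar R).
  by apply/measurable_EFinP; exact: measurable_indic.
have i0 y x : 0 <= (\1_(h @^-1` [set y]) x)%:E :> \bar R by rewrite lee_fin.
have -> : EFin \o h = fun x => \sum_(y <- s) y%:E * (\1_(h @^-1` [set y]) x)%:E.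
  apply/funext => x; rewrite /= fimfunE hs -fsbig_seq ?undup_uniq//= -sumEFin.
  by apply: eq_bigr => y _; rewrite EFinM.
have : forall y, y \in s -> (0 <= y)%R.
  move=> y ys; have : range h y by rewrite hs.
  by move=> [x _ <-].
elim: s {hs hs0} => [_|y s IH sy0].
  under eq_fun do rewrite big_nil.
  (* [Phi] vanishes at zero by homogeneity with the constant [0]. *)
  rewrite big_nil -[RHS](mul0e (Phi (cst 0))) -PhiZ//.
  by congr Phi; apply/funext => x; rewrite mul0e.
have s0' z : z \in s -> (0 <= z)%R by move=> zs; apply: sy0; rewrite inE zs orbT.
have y0 : (0 <= y)%R by apply: sy0; rewrite mem_head.
under eq_fun do rewrite big_cons.
rewrite big_cons PhiD.
- by rewrite PhiZ// IH.
- exact: measurable_funeM.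
- by move=> x; rewrite mule_ge0.
- apply: emeasurable_sum => z; exact: measurable_funeM.
- move=> x; rewrite big_seq; apply: sume_ge0 => z zs; rewrite mule_ge0// lee_fin.
  exact: s0'.
Qed.

(** Agreement on indicators extends to simple functions by additivity and homogeneity, then to
    nonnegative measurable functions along increasing simple approximations. *)
Lemma eq_positive_functional Phi Psi :
  positive_functional Phi -> positive_functional Psi ->
  (forall A, measurable A ->
    Phi (fun x => (\1_A x)%:E) = Psi (fun x => (\1_A x)%:E)) ->
  forall f, measurable_fun setT f -> (forall x, 0 <= f x) -> Phi f = Psi f.
Proof.
move=> pPhi pPsi eqA f mf f0; pose h := nnsfun_approx measurableT mf.
have -> : f = fun x => limn (fun n => (EFin \o h n) x).
  apply/funext => x; apply/esym/cvg_lim => //.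
  by apply: cvg_nnsfun_approx => // y _; exact: f0.
have [_ _ ->] := pPhi.
- have [_ _ ->] := pPsi.
  + congr (limn _); apply/funext => n.
    have [s hs] := positive_functional_nnsfun (h n); rewrite !hs//.
    by apply: eq_bigr => y _; rewrite eqA.
  + by move=> n; exact/measurable_EFinP.
  + by move=> n x; rewrite lee_fin.
  + by move=> x m n mn; rewrite lee_fin; exact/lefP/nd_nnsfun_approx.
- by move=> n; exact/measurable_EFinP.
- by move=> n x; rewrite lee_fin.
- by move=> x m n mn; rewrite lee_fin; exact/lefP/nd_nnsfun_approx.
Qed.

End positive_functional.

Section weighted_integral.
Local Open Scope ereal_scope.
Context d d' (S : measurableType d) (T : measurableType d') (R : realType).
Variables (mu : {measure set S -> \bar R}) (D : set S) (w : S -> R) (Y : S -> T).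
Hypotheses (mD : measurable D) (mw : measurable_fun D w)
  (mY : measurable_fun D Y) (w0 : forall x, D x -> (0 <= w x)%R).

(** The weight and the map make one lemma serve for laws (weight [1]), for densities (identity map)
    and for a product with all factors but one held fixed. *)
Lemma positive_functional_integral : positive_functional
  (fun f : T -> \bar R => \int[mu]_(x in D) ((w x)%:E * f (Y x))).
Proof.
have mwf f : measurable_fun setT f -> measurable_fun D (fun x => (w x)%:E * f (Y x)).
  move=> mf; apply: emeasurable_funM; first exact/measurable_EFinP.
  exact: measurableT_comp.
have wf0 (f : T -> \bar R) x : (forall y, 0 <= f y) -> D x -> 0 <= (w x)%:E * f (Y x).
  by move=> f0 Dx; rewrite mule_ge0// lee_fin w0.
split.
- move=> f g mf f0 mg g0; rewrite -ge0_integralD//.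
  + apply: eq_integral => x; rewrite inE => Dx; rewrite ge0_muleDr//.
  + by move=> x; exact: wf0.
  + exact: mwf.
  + by move=> x; exact: wf0.
  + exact: mwf.
- move=> c f c0 mf f0; rewrite -ge0_integralZl//.
  + by apply: eq_integral => x _; rewrite muleCA.
  + exact: mwf.
  + by move=> x; exact: wf0.
- move=> f mf f0 ndf; rewrite -monotone_convergence//.
  + apply: eq_integral => x; rewrite inE => Dx; apply/esym/cvg_lim => //.
    apply: cvgeZl => //; apply: ereal_nondecreasing_is_cvgn; exact: ndf.
  + by move=> n; exact: mwf.
  + by move=> n x Dx; exact: wf0.
  + by move=> x Dx m n mn; rewrite lee_wpmul2l ?lee_fin ?w0//; exact: ndf.
Qed.

End weighted_integral.

Section independence.
Context d (T : measurableType d) (R : realType) (P : probability T R).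

Lemma density_expectation (X : {RV P >-> R}) (D : set R) (h : R -> R) :
  measurable D -> measurable_fun D h -> (forall x, D x -> 0 <= h x) ->
  has_density_on X D h ->
  forall f : R -> \bar R, measurable_fun setT f -> (forall x, 0 <= f x)%E ->
  (\int[P]_t f (X t) = \int[lebesgue_measure]_(x in D) ((h x)%:E * f x))%E.
Proof.
move=> mD mh h0 hX f mf f0.
have mX : measurable_fun setT X by [].
have pf1 := @positive_functional_integral _ _ _ _ _ P setT (cst 1) X measurableT
  (measurable_cst _) mX (fun _ _ => ler01).
have pf2 := @positive_functional_integral _ _ _ R _ lebesgue_measure D h id mD mh
  (@measurable_id _ _ _) h0.
have := eq_positive_functional pf1 pf2 _ mf f0.
under eq_integral do rewrite mul1e.
apply => A mA.
under eq_integral do rewrite mul1e.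
rewrite -[LHS]/(\int[P]_t (\1_(X @^-1` A) t)%:E)%E integral_indic//; last first.
  by rewrite -[_ @^-1` _]setTI; exact: mX.
rewrite setIT; etransitivity; first exact: hX.
rewrite integral_mkcondl; apply: eq_integral => x _.
by rewrite patchE indicE; case: ifPn => xA; rewrite ?mule1 ?mule0.
Qed.

(* The indicator functions are replaced by arbitrary functions one coordinate at a
   time. *)
Lemma independent_expectation (k : nat) (X : 'I_k -> {RV P >-> R})
    (g : 'I_k -> R -> R) :
  mutually_independent X ->
  (forall j, measurable_fun setT (g j)) -> (forall j x, 0 <= g j x <= 1) ->
  \int[P]_t (\prod_(j < k) g j (X j t)) = \prod_(j < k) \int[P]_t g j (X j t).
Proof.
move=> indX.
have PT : (P setT < +oo)%E by rewrite probability_setT ltry.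
have mX j : measurable_fun setT (X j) by [].
have mprod (J : pred 'I_k) (h : 'I_k -> R -> R) : (forall j, measurable_fun setT (h j)) ->
    measurable_fun setT (fun t => \prod_(j < k | J j) h j (X j t)).
  move=> mh; rewrite (_ : (fun _ => _) =
      \big[(fun f g t => f t * g t)/(fun=> 1)]_(j < k | J j) (fun t => h j (X j t))).
    elim/big_rec: _ => [|j f _ mf]; first exact: measurable_cst.
    by apply: measurable_funM => //; exact: (measurableT_comp (mh j) (mX j)).
  by apply/funext => t; elim/big_rec2: _ => // j x f _ ->.
have iE (h : R -> R) j : measurable_fun setT h -> (forall x, 0 <= h x <= 1) ->
    (\int[P]_t (h (X j t))%:E)%E = (\int[P]_t h (X j t))%:E.
  move=> mh h01; rewrite fineK//; apply: integrable_fin_num => //.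
  apply: (@bounded_integrable _ _ _ P setT measurableT PT _ 1).
    exact: (measurableT_comp mh (mX j)).
  by move=> t _; have /andP[h0 h1] := h01 (X j t); rewrite ger0_norm.
(* Coordinates before [m] carry arbitrary functions, the others still carry indicators: [m = 0] is
   independence itself, [m = k] the claim. *)
suff H (m : nat) : forall h : 'I_k -> R -> R,
   (forall j, measurable_fun setT (h j)) -> (forall j x, 0 <= h j x <= 1) ->
   (forall j : 'I_k, (m <= j)%N -> exists2 A : set R, measurable A & h j = \1_A) ->
   (\int[P]_t (\prod_(j < k) h j (X j t))%:E)%E = (\prod_(j < k) \int[P]_t h j (X j t))%:E.
  move=> mg g01; rewrite [LHS]/Rintegral (H k)// => j.
  by rewrite leqNgt ltn_ord.
elim: m => [|m IH] h mh h01 hA.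
  have /choice[A hA'] : forall j, exists A : set R, measurable A /\ h j = \1_A.
    by move=> j; have [//|A mA ->] := hA j; exists A.
  have mA j : measurable (A j) by have [] := hA' j.
  have mXA j : measurable (X j @^-1` A j).
    by rewrite -[_ @^-1` _]setTI; exact: mX.
  have := indX [set: 'I_k]%SET A mA.
  have -> : \bigcap_(j in [set` [set: 'I_k]%SET]) (X j @^-1` A j) =
      [set t | forall j, A j (X j t)].
    by apply/seteqP; split => t /= h1 j => [|_]; apply: h1; rewrite /= inE.
  have mI : measurable [set t | forall j, A j (X j t)].
    rewrite (_ : [set t | _] = \bigcap_(j in [set: 'I_k]) (X j @^-1` A j)).
      by apply: fin_bigcap_measurable.
    by apply/seteqP; split => t /= h1 j => [_|]; apply: h1.
  have -> : (\int[P]_t (\prod_(j < k) h j (X j t))%:E)%E = P [set t | forall j, A j (X j t)].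
    transitivity (\int[P]_t (\1_[set t | forall j, A j (X j t)] t)%:E)%E; last first.
      by rewrite integral_indic// setIT.
    apply: eq_integral => t _; congr EFin.
    rewrite indicE; case: (boolP (t \in _)) => [/set_mem/= tA|tA].
      rewrite big1// => j _; have [_ ->] := hA' j.
      by rewrite indicE mem_set.
    move: tA; rewrite notin_setE/= => /existsNP[j jA].
    rewrite (bigD1 j)//=; have [_ ->] := hA' j.
    by rewrite indicE memNset// mul0r.
  move=> ->; rewrite big_mkcond/= -prodEFin; apply: eq_bigr => j _.
  rewrite inE -iE//; have [_ ->] := hA' j.
  by rewrite -[RHS]/(\int[P]_t (\1_(X j @^-1` A j) t)%:E)%E integral_indic// setIT.
have [km|mk] := leqP k m.
  by apply: IH => // j mj; exfalso; have := leq_trans km mj; rewrite leqNgt ltn_ord.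
pose i := Ordinal mk.
(* As functionals of the function at coordinate [i], the two sides are integration with weight [w]
   and with the constant weight [c]; by the induction hypothesis they agree on indicators. *)
pose w t := \prod_(j < k | j != i) h j (X j t).
pose c := \prod_(j < k | j != i) \int[P]_t h j (X j t).
have w0 t : 0 <= w t by apply: prodr_ge0 => j _; have /andP[] := h01 j (X j t).
have c0 : 0 <= c.
  by apply: prodr_ge0 => j _; apply: Rintegral_ge0 => t _; have /andP[] := h01 j (X j t).
have pf1 := @positive_functional_integral _ _ _ _ _ P setT w (X i) measurableT
  (mprod _ _ mh) (mX i) (fun x _ => w0 x).
have pf2 := @positive_functional_integral _ _ _ _ _ P setT (cst c) (X i) measurableT
  (measurable_cst _) (mX i) (fun _ _ => c0).
have h0 x : (0 <= (h i x)%:E)%E by rewrite lee_fin; have /andP[] := h01 i x.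
have mhi : measurable_fun setT (EFin \o h i) by exact/measurable_EFinP.
have := eq_positive_functional pf1 pf2 _ mhi h0.
have Zc (f : R -> R) : measurable_fun setT f -> (forall x, 0 <= f x <= 1) ->
    (\int[P]_t (c%:E * (f (X i t))%:E))%E = (c * \int[P]_t f (X i t))%:E.
  move=> mf f01; rewrite ge0_integralZl_EFin//; first by rewrite iE.
    by move=> t _; rewrite lee_fin; have /andP[] := f01 (X i t).
  by apply/measurable_EFinP; exact: (measurableT_comp mf (mX i)).
have splitE (f : 'I_k -> R -> R) : (forall j, j != i -> f j = h j) ->
    (\int[P]_t ((w t)%:E * (f i (X i t))%:E))%E =
    (\int[P]_t (\prod_(j < k) f j (X j t))%:E)%E.
  move=> fh; apply: eq_integral => t _; rewrite -EFinM (bigD1 i)//= mulrC.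
  by congr (_ * _)%:E; apply: eq_bigr => j ji; rewrite fh.
have splitc (f : 'I_k -> R -> R) : (forall j, j != i -> f j = h j) ->
    c * \int[P]_t f i (X i t) = \prod_(j < k) \int[P]_t f j (X j t).
  move=> fh; rewrite (bigD1 i)//= mulrC; congr (_ * _).
  by apply: eq_bigr => j ji; rewrite fh.
rewrite -(splitE h)// -(splitc h)// => ->; first exact: Zc.
move=> A mA; pose f j := if j == i then \1_A else h j.
have fh j : j != i -> f j = h j by rewrite /f => /negbTE ->.
have fi : f i = \1_A by rewrite /f eqxx.
have i01 x : 0 <= (\1_A x : R) <= 1 by rewrite indicE; case: (x \in A) => /=; rewrite ?lexx ?ler01.
rewrite Zc//; rewrite -fi splitE// splitc//; apply: IH.
- by move=> j; rewrite /f; case: eqP.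
- by move=> j x; rewrite /f; case: eqP.
- move=> j mj; rewrite /f; case: eqP => [_|ji]; first by exists A.
  apply: hA; rewrite ltn_neqAle mj andbT; apply/eqP => mE; apply: ji.
  exact/val_inj.
Qed.

End independence.

(** * Gaussian vectors and quadratic forms *)

Section quadratic_forms.
Variable R : realType.

Definition qform (k : nat) (A : 'M[R]_k) (u : 'cV[R]_k) : R := (u^T *m A *m u) 0 0.

Lemma mx11_tr (M : 'M[R]_1) : M^T = M.
Proof. by apply/matrixP => i j; rewrite mxE !ord1. Qed.

Lemma qformD (k : nat) (D : 'M[R]_k) (u z b : 'cV[R]_k) (t : R) :
  D^T = D -> D *m z = b ->
  qform D (u + t *: z) = qform D u + 2 * t * (b^T *m u) 0 0 + t ^+ 2 * (b^T *m z) 0 0.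
Proof.
move=> sD Dz; have zD : z^T *m D = b^T by rewrite -Dz trmx_mul sD.
have ub : u^T *m b = b^T *m u by rewrite -[RHS]mx11_tr trmx_mul trmxK.
have -> : qform D (u + t *: z) = ((u^T + t *: z^T) *m D *m (u + t *: z)) 0 0.
  by congr ((_ *m _ *m _) 0 0); apply/matrixP => i j; rewrite !mxE.
rewrite /qform !mulmxDl !mulmxDr -!scalemxAl -!scalemxAr zD.
rewrite -[u^T *m D *m z]mulmxA Dz ub scalerA !mxE -!expr2; ring.
Qed.

Lemma qform_block (k : nat) (a : R) (b u : 'cV[R]_k) (D : 'M[R]_k) (t : R) :
  qform (block_mx a%:M (b^T) b D : 'M[R]_(1 + k)) (col_mx t%:M u) =
  a * t ^+ 2 + 2 * t * (b^T *m u) 0 0 + qform D u.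
Proof.
have ub : u^T *m b = b^T *m u by rewrite -[RHS]mx11_tr trmx_mul trmxK.
rewrite /qform tr_col_mx mul_row_block mul_row_col tr_scalar_mx.
rewrite !mulmxDl ub !mul_scalar_mx !mul_mx_scalar -scalemxAl !mxE eqxx mulr1n; ring.
Qed.

Lemma posdefmx_block (k : nat) (A : 'M[R]_k.+1) : posdefmx A ->
  exists a (b : 'cV[R]_k) (D : 'M[R]_k),
    A = (block_mx a%:M (b^T) b D : 'M[R]_(1 + k)) /\ posdefmx D.
Proof.
move=> [sA pA]; pose A' : 'M[R]_(1 + k) := A.
exists (ulsubmx A' 0 0), (dlsubmx A'), (drsubmx A').
have eA : A = (block_mx (ulsubmx A' 0 0)%:M ((dlsubmx A')^T) (dlsubmx A') (drsubmx A') : 'M[R]_(1 + k)).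
  have eur : ursubmx A' = (dlsubmx A')^T by rewrite trmx_dlsub -[A'^T]/(A^T) sA.
  by rewrite -eur -mx11_scalar submxK.
split => //; split; first by rewrite trmx_drsub -[A'^T]/(A^T) sA.
move=> u u0; have := pA (col_mx 0%:M u : 'cV[R]_(1 + k)).
rewrite -/(qform A _) eA qform_block expr0n/= !mulr0 mul0r !add0r; apply.
apply: contra_neq u0 => h.
by have := f_equal (@dsubmx _ 1 k 1) h; rewrite col_mxKd linear0.
Qed.

(** Here $s$ is the Schur complement $a-b^TD^{-1}b$, positive as the value of the form at $(1,-z)$;
    the determinant comes from a block triangular factorisation. That $D$ is invertible is supplied
    by the induction in [gaussian_integral]. *)
Lemma posdefmx_schur (k : nat) (a : R) (b : 'cV[R]_k) (D : 'M[R]_k) :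
  posdefmx (block_mx a%:M (b^T) b D : 'M[R]_(1 + k)) -> posdefmx D -> \det D != 0 ->
  exists z s, [/\ D *m z = b, s = a - (b^T *m z) 0 0, 0 < s &
    \det (block_mx a%:M (b^T) b D : 'M[R]_(1 + k)) = s * \det D].
Proof.
move=> [sA pA] [sD pD] D0.
have uD : D \in unitmx by rewrite unitmxE unitfE.
have [z Dz] : exists z, D *m z = b.
  by exists (invmx D *m b); rewrite mulmxA mulmxV// mul1mx.
exists z, (a - (b^T *m z) 0 0); split => //.
  have := pA (col_mx 1%:M (- z) : 'cV[R]_(1 + k)).
  rewrite -/(qform _ _) qform_block.
  have -> : qform D (- z) = (b^T *m z) 0 0.
    have := qformD 0 (-1) sD Dz; rewrite add0r scaleN1r => ->.
    by rewrite /qform mulmx0 mulmx0 !mxE; ring.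
  rewrite mulmxN mxE => h; have {}h := h _.
  rewrite (_ : a - _ = a * 1 ^+ 2 + 2 * 1 * - (b^T *m z) 0 0 + (b^T *m z) 0 0); last by ring.
  apply: h; apply/eqP => h0.
  have := f_equal (fun M => usubmx (M : 'M[R]_(1 + k, 1)) 0 0) h0.
  by rewrite /= col_mxKu linear0 !mxE eqxx => /eqP; rewrite oner_eq0.
set s := a - _.
have -> : (block_mx a%:M (b^T) b D : 'M[R]_(1 + k)) =
    block_mx 1%:M (z^T) 0 1%:M *m block_mx s%:M 0 b D.
  rewrite mulmx_block !mul1mx !mul0mx !add0r.
  have zD : z^T *m D = b^T by rewrite -Dz trmx_mul sD.
  congr block_mx; last by rewrite zD.
  have -> : z^T *m b = b^T *m z by rewrite -[RHS]mx11_tr trmx_mul trmxK.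
  rewrite [b^T *m z]mx11_scalar -raddfD/= /s subrK//.
by rewrite det_mulmx det_ublock det_lblock !det1 !mul1r det_scalar expr1.
Qed.

End quadratic_forms.

Section gaussian_integral.
Variable R : realType.
Local Notation mu := (@lebesgue_measure R).

(** The integral of the normal density with mean $-y$ and variance $1/s$. *)
Lemma integral_expR_sqr (c s y : R) : 0 < s ->
  (\int[mu]_x (expR (- (2^-1 * (c + s * (x + y) ^+ 2))))%:E =
   ((2 * pi) `^ 2^-1 * s `^ (- 2^-1) * expR (- (2^-1 * c)))%:E)%E.
Proof.
move=> s0; pose sg : R := Num.sqrt s^-1.
have sg0 : sg != 0 by rewrite gt_eqF// sqrtr_gt0 invr_gt0.
have sg2 : sg ^+ 2 = s^-1 by rewrite sqr_sqrtr// invr_ge0 ltW.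
have p0 : 0 < normal_peak sg by exact: normal_peak_gt0.
have pE : (normal_peak sg)^-1 = (2 * pi) `^ 2^-1 * s `^ (- 2^-1).
  rewrite /normal_peak invrK sg2 powRN !powR12_sqrt ?(ltW s0) ?mulr_ge0 ?pi_ge0//.
  rewrite -sqrtrV ?(ltW s0)// -sqrtrM ?mulr_ge0 ?pi_ge0//; congr Num.sqrt.
  by rewrite -mulr_natl; ring.
have := @integral_normal_pdf R (- y) sg; rewrite normal_pdfE// => h.
transitivity ((((normal_peak sg)^-1 * expR (- (2^-1 * c)))%:E *
    \int[mu]_x (normal_peak sg * normal_fun (- y) sg x)%:E)%E)%E; last first.
  by rewrite h mule1 pE.
rewrite -ge0_integralZl//.
- apply: eq_integral => x _; rewrite -EFinM /normal_fun opprK sg2; congr EFin.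
  rewrite mulrACA mulVf ?(gt_eqF p0)// mul1r -expRD; congr expR.
  by rewrite -mulr_natr; field; rewrite gt_eqF.
- apply/measurable_EFinP; apply: measurable_funM => //; exact: measurable_normal_fun.
- by move=> x _; rewrite lee_fin mulr_ge0 ?normal_fun_ge0// ltW.
- by rewrite lee_fin mulr_ge0 ?expR_ge0// invr_ge0 ltW.
Qed.

(* The shift [y] makes the induction go through: integrating out the last [k]
   variables completes a square, with a shift linear in the first variable. *)
Theorem gaussian_integral (k : nat) (A : 'M[R]_k) : posdefmx A ->
  0 < \det A /\ forall (y : 'cV[R]_k) (c : R),
  integral_tuple (fun u : k.-tuple R =>
    (expR (- (2^-1 * (c + qform A (\col_j tnth u j + y)))))%:E) =
  ((2 * pi) `^ (k%:R / 2) * (\det A) `^ (- 2^-1) * expR (- (2^-1 * c)))%:E.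
Proof.
elim: k A => [|k IH] A pA.
  rewrite det_mx00; split => // y c /=.
  rewrite mul0r powRr0 powR1 !mul1r /qform mxE big_ord0 addr0//.
have [a [b [D [eA pD]]]] := posdefmx_block pA.
have [D0 {}IH] := IH D pD.
rewrite eA in pA; have [z [s [Dz sE s0 dA]]] := posdefmx_schur pA pD (lt0r_neq0 D0).
rewrite eA dA; split; first by rewrite mulr_gt0.
move=> y c /=.
pose y1 : R := (usubmx (y : 'cV[R]_(1 + k))) 0 0.
pose y2 : 'cV[R]_k := dsubmx (y : 'cV[R]_(1 + k)).
pose C : R := (2 * pi) `^ (k%:R / 2) * (\det D) `^ (- 2^-1).
have C0 : 0 <= C by rewrite mulr_ge0 ?powR_ge0.
transitivity (\int[mu]_x (C%:E * (expR (- (2^-1 * (c + s * (x + y1) ^+ 2))))%:E))%E.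
  (* At fixed $x$ the form is $s(x+y_1)^2$ plus the form of $D$ at $u+y_2+(x+y_1)z$, so the
     induction hypothesis applies with this shift and with the square moved into the constant. *)
  apply: eq_integral => x _; rewrite -EFinM -(IH (y2 + (x + y1) *: z)).
  congr integral_tuple; apply/funext => u; congr (expR (- (2^-1 * _)))%:E.
  rewrite -addrA; congr (_ + _).
  have -> : \col_j tnth [tuple of x :: u] j + y =
      (col_mx (x + y1)%:M (\col_j tnth u j + y2) : 'cV[R]_(1 + k)).
    apply/matrixP => i j; rewrite !ord1 {j} -[y](vsubmxK (y : 'cV[R]_(1 + k))).
    rewrite !mxE; case: (@splitP 1 k i) => j ij; rewrite ?mxE.
      rewrite (_ : i = 0); last by apply/val_inj; rewrite /= ij ord1.
      by rewrite ord1 /y1 mxE eqxx mulr1n tnth0.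
    rewrite (_ : i = lift 0 j); last by apply/val_inj; rewrite /= ij.
    by rewrite tnthS.
  rewrite qform_block addrA (qformD _ _ _ Dz); last by case: pD.
  rewrite sE; ring.
rewrite ge0_integralZl//.
- rewrite integral_expR_sqr// -EFinM; congr EFin.
  have -> : (k.+1%:R / 2 : R) = k%:R / 2 + 2^-1 by rewrite -natr1; field.
  rewrite powRD; last by rewrite gt_eqF ?implybT// mulr_gt0 ?pi_gt0.
  by rewrite (powRM _ (ltW s0) (ltW D0)) /C; ring.
- apply/measurable_EFinP; apply: measurableT_comp => //.
  apply: measurableT_comp => //; apply: measurable_funM => //.
  apply: measurable_funD => //; apply: measurable_funM => //.
  by apply: measurable_funX; exact: measurable_funD.
Qed.

End gaussian_integral.

(** * Iterated integrals as positive functionals *)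

Section integral_tuple.
Variable R : realType.
Local Open Scope ereal_scope.
Local Notation mu := (@lebesgue_measure R).

Lemma integral_tuple_ge0 k (f : k.-tuple R -> \bar R) :
  (forall u, 0 <= f u) -> 0 <= integral_tuple f.
Proof.
elim: k f => [|k IH] f f0 /=; first exact: f0.
by apply: integral_ge0 => x _; apply: IH => u; exact: f0.
Qed.

(** The parameter space is arbitrary so that the induction can absorb the first variable into it;
    integrating that variable out is Tonelli's theorem. *)
Lemma measurable_integral_tuple (k : nat) d (S : measurableType d)
    (F : S * k.-tuple R -> \bar R) :
  measurable_fun setT F -> (forall p, 0 <= F p) ->
  measurable_fun setT (fun s => integral_tuple (fun u => F (s, u))).
Proof.
elim: k d S F => [|k IH] d S F mF F0 /=.
  apply: (measurableT_comp mF).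
  by apply: measurable_fun_pair => //; exact: measurable_cst.
pose G (p : S * measurableTypeR R) : \bar R :=
  integral_tuple (fun u : k.-tuple R => F (p.1, [tuple of p.2 :: u])).
have mG : measurable_fun setT G.
  apply: (IH _ _ (fun q : (S * measurableTypeR R) * k.-tuple R =>
    F (q.1.1, [tuple of q.1.2 :: q.2]))) => //.
  apply: (measurableT_comp mF); apply: measurable_fun_pair.
    by apply: (measurableT_comp measurable_fst); exact: measurable_fst.
  apply: (@measurable_cons _ _ _ R (fun q : (S * measurableTypeR R) * k.-tuple R => q.1.2) k snd).
    by apply: (measurableT_comp measurable_snd); exact: measurable_fst.
  exact: measurable_snd.
have G0 p : 0 <= G p.
  by apply: integral_tuple_ge0 => u; exact: F0.
exact: (measurable_fun_fubini_tonelli_F (m2 := mu) G mG G0).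
Qed.

Let measurable_section k (f : k.+1.-tuple R -> \bar R) (x : R) :
  measurable_fun setT f -> measurable_fun setT (fun u : k.-tuple R => f [tuple of x :: u]).
Proof.
move=> mf; apply: (measurableT_comp mf).
by apply: (@measurable_cons _ _ _ R (cst x) k id) => //; exact: measurable_cst.
Qed.

Let measurable_inner k (f : k.+1.-tuple R -> \bar R) :
  measurable_fun setT f -> (forall u, 0 <= f u) ->
  measurable_fun setT
    (fun x : measurableTypeR R => integral_tuple (fun u : k.-tuple R => f [tuple of x :: u])).
Proof.
move=> mf f0.
apply: (@measurable_integral_tuple k _ (measurableTypeR R) (fun p => f [tuple of p.1 :: p.2])) => //.
apply: (measurableT_comp mf).
apply: (@measurable_cons _ _ _ R (fun q : measurableTypeR R * k.-tuple R => q.1) k snd).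
  exact: measurable_fst.
exact: measurable_snd.
Qed.

Lemma le_integral_tuple k (f g : k.-tuple R -> \bar R) :
  measurable_fun setT f -> (forall u, 0 <= f u) -> measurable_fun setT g ->
  (forall u, f u <= g u) -> integral_tuple f <= integral_tuple g.
Proof.
elim: k f g => [|k IH] f g mf f0 mg fg /=; first exact: fg.
have g0 u : 0 <= g u by exact: le_trans (fg u).
apply: ge0_le_integral => //.
- by move=> x _; apply: integral_tuple_ge0.
- exact: measurable_inner.
- exact: measurable_inner.
- by move=> x _; apply: IH => //; exact: measurable_section.
Qed.

Lemma positive_functional_integral_tuple k :
  positive_functional (fun f : k.-tuple R -> \bar R => integral_tuple f).
Proof.
elim: k => [|k [IHD IHZ IHM]]; first by split.
split => /=.
- move=> f g mf f0 mg g0; rewrite -ge0_integralD//.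
  + apply: eq_integral => x _; apply: IHD => //; exact: measurable_section.
  + by move=> x _; exact: integral_tuple_ge0.
  + exact: measurable_inner.
  + by move=> x _; exact: integral_tuple_ge0.
  + exact: measurable_inner.
- move=> c f c0 mf f0; rewrite -ge0_integralZl//.
  + apply: eq_integral => x _; apply: IHZ => //; exact: measurable_section.
  + exact: measurable_inner.
  + by move=> x _; exact: integral_tuple_ge0.
- move=> f mf f0 ndf; rewrite -monotone_convergence//.
  + apply: eq_integral => x _; apply: IHM => // n; exact: measurable_section.
  + by move=> n; exact: measurable_inner.
  + by move=> n x _; exact: integral_tuple_ge0.
  + move=> x _ m n mn; apply: le_integral_tuple => //.
    * exact: measurable_section.
    * exact: measurable_section.
    * by move=> u; exact: ndf.
Qed.

Lemma positive_functional_weight d (T : measurableType d)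
    (Phi : (T -> \bar R) -> \bar R) (w : T -> R) :
  positive_functional Phi -> measurable_fun setT w -> (forall x, (0 <= w x)%R) ->
  positive_functional (fun f => Phi (fun x => (w x)%:E * f x)).
Proof.
move=> [PD PZ PM] mw w0.
have mwf f : measurable_fun setT f -> measurable_fun setT (fun x => (w x)%:E * f x).
  by move=> mf; apply: emeasurable_funM => //; exact/measurable_EFinP.
have wf0 (f : T -> \bar R) : (forall x, 0 <= f x) -> forall x, 0 <= (w x)%:E * f x.
  by move=> f0 x; rewrite mule_ge0// lee_fin.
split.
- move=> f g mf f0 mg g0; rewrite -PD; [|exact: mwf|exact: wf0|exact: mwf|exact: wf0].
  by congr Phi; apply/funext => x; rewrite ge0_muleDr.
- move=> c f c0 mf f0; rewrite -PZ//; [|exact: mwf|exact: wf0].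
  by congr Phi; apply/funext => x; rewrite muleCA.
- move=> f mf f0 ndf; rewrite -PM.
  + congr Phi; apply/funext => x; apply/esym/cvg_lim => //.
    by apply: cvgeZl => //; apply: ereal_nondecreasing_is_cvgn; exact: ndf.
  + by move=> n; exact: mwf.
  + by move=> n; exact: wf0.
  + by move=> x m n mn; rewrite lee_wpmul2l ?lee_fin ?w0//; exact: ndf.
Qed.

End integral_tuple.

Section gaussian_vector.
Context d (T : measurableType d) (R : realType) (P : probability T R).
Variables (k : nat) (X : 'I_k -> {RV P >-> R}) (Sigma : 'M[R]_k).

Lemma measurable_qform (A : 'M[R]_k) :
  measurable_fun setT (fun u : k.-tuple R => qform A (\col_j tnth u j)).
Proof.
rewrite (_ : (fun _ => _) = fun u : k.-tuple R =>
    \sum_j (\sum_i tnth u i * A i j) * tnth u j).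
  apply: measurable_sum => j; apply: measurable_funM; last exact: measurable_tnth.
  apply: measurable_sum => i; apply: measurable_funM => //; exact: measurable_tnth.
apply/funext => u; rewrite /qform mxE; apply: eq_bigr => j _; rewrite !mxE.
by congr (_ * _); apply: eq_bigr => i _; rewrite !mxE.
Qed.

Lemma measurable_gaussian_pdf : measurable_fun setT (@gaussian_pdf R k Sigma).
Proof.
apply: measurable_funM => //; apply: measurableT_comp => //.
apply: measurableT_comp => //; apply: measurable_funM => //.
exact: (measurable_qform (invmx Sigma)).
Qed.

Lemma gaussian_pdf_ge0 u : 0 <= gaussian_pdf Sigma u.
Proof. by rewrite /gaussian_pdf !mulr_ge0 ?powR_ge0 ?expR_ge0. Qed.

Lemma gaussian_expectation (phi : k.-tuple R -> \bar R) :
  gaussian_vector X Sigma ->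
  measurable_fun setT phi -> (forall u, 0 <= phi u)%E ->
  (\int[P]_t phi [tuple X j t | j < k] =
   integral_tuple (fun u => (gaussian_pdf Sigma u)%:E * phi u))%E.
Proof.
move=> gX mphi phi0.
pose Y t := [tuple X j t | j < k].
have mY : measurable_fun setT Y.
  apply/measurable_fun_tnthP => i; rewrite (_ : _ \o _ = X i)//.
  by apply/funext => t; rewrite /= tnth_mktuple.
have pf1 := @positive_functional_integral _ _ _ _ _ P setT (cst 1) Y measurableT
  (measurable_cst _) mY (fun _ _ => ler01).
have pf2 := positive_functional_weight (positive_functional_integral_tuple R k)
  measurable_gaussian_pdf gaussian_pdf_ge0.
have := eq_positive_functional pf1 pf2 _ mphi phi0.
under eq_integral do rewrite mul1e.
apply => A mA.
under eq_integral do rewrite mul1e.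
rewrite -[LHS]/(\int[P]_t (\1_(Y @^-1` A) t)%:E)%E integral_indic//; last first.
  by rewrite -[_ @^-1` _]setTI; exact: mY.
by rewrite setIT; exact: gX.
Qed.

End gaussian_vector.

(** * Sums of independent gamma variables *)

Section gamma_sums.
Context d (T : measurableType d) (R : realType) (P : probability T R).

Lemma Rintegral_cdf (D : set T) (S : T -> R) (x : R) :
  measurable D -> P D = 1%E -> measurable_fun setT S ->
  P [set t | S t <= x] = (\int[P]_(t in D) (S t <= x)%R%:R)%:E.
Proof.
move=> mD PD mS; set E := [set t | S t <= x].
have mE : measurable E.
  rewrite (_ : E = S @^-1` `]-oo, x]).
    by rewrite -[_ @^-1` _]setTI; apply: mS => //; exact: measurable_itv.
  by apply/seteqP; split => t /=; rewrite in_itv.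
have -> : P E = P (E `&` D).
  have PDc : P (~` D) = 0%E by rewrite probability_setC// PD subee.
  have mDc : measurable (~` D) by exact: measurableC.
  apply/eqP; rewrite eq_le; apply/andP; split; last first.
    by apply: le_measure; rewrite ?inE//; exact: measurableI.
  apply: (@le_trans _ _ (P ((E `&` D) `|` ~` D))).
    apply: le_measure; rewrite ?inE//.
      by apply: measurableU => //; exact: measurableI.
    by move=> t Et; have [Dt|Dt] := pselect (D t); [left|right].
  apply: le_trans (measureU2 _ _ _) _ => //; first exact: measurableI.
  by rewrite [X in (_ + X)%E](_ : _ = 0%E) ?adde0.
have eI : (\int[P]_(t in D) ((S t <= x)%R%:R : R)%:E)%E = P (E `&` D).
  rewrite -integral_indic//; apply: eq_integral => t _.
  by rewrite indicE /E mem_setE.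
by rewrite /Rintegral eI fineK// fin_num_measure//; exact: measurableI.
Qed.

(** The indicator keeps the integrand within $[0,1]$ for every real value of the variable, as
    [independent_expectation] demands. *)
Lemma gamma_laplace (X : {RV P >-> R}) (a lam m : R) :
  0 < a -> 0 < lam -> 0 <= m ->
  has_density_on X `]0, +oo[ (fun x => lam^-1 * gamma_pdf a (lam^-1 * x)) ->
  \int[P]_t ((0 < X t)%R%:R * expR (- (m * X t))) = (1 + m * lam) `^ (- a).
Proof.
move=> a0 l0 m0 hX; have li0 : 0 < lam^-1 by rewrite invr_gt0.
have mlam : 0 <= m * lam by rewrite mulr_ge0// ltW.
have m0lt : measurable_fun setT (fun y : R => (0 < y)%R%:R : R).
  rewrite (_ : (fun _ => _) = \1_[set` `]0, +oo[]).
    by apply: measurable_indic; exact: measurable_itv.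
  by apply/funext => t; rewrite indicE mem_setE in_itv/= andbT.
have me c : measurable_fun setT (fun y : R => expR (- (c * y))).
  by apply: measurableT_comp => //; apply: measurableT_comp => //; exact: measurable_funM.
have mg : measurable_fun setT (fun x => lam^-1 * gamma_pdf a (lam^-1 * x)).
  apply: measurable_funM => //; apply: (measurableT_comp (measurable_gamma_pdf a)).
  exact: measurable_funM.
have mpos : measurable ([set` `]0, +oo[] : set R) by exact: measurable_itv.
have h0 (x : R) : [set` `]0, +oo[] x -> 0 <= lam^-1 * gamma_pdf a (lam^-1 * x).
  by move=> _; rewrite mulr_ge0 ?(ltW li0) ?gamma_pdf_ge0.
have mf : measurable_fun setT (fun x : R => ((0 < x)%R%:R * expR (- (m * x)))%:E).
  by apply/measurable_EFinP; exact: measurable_funM.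
have f0 (x : R) : (0 <= ((0 < x)%R%:R * expR (- (m * x)))%:E)%E.
  by rewrite lee_fin mulr_ge0 ?expR_ge0.
rewrite /Rintegral (density_expectation mpos (measurable_funTS mg) h0 hX mf f0).
pose f y := (gamma_pdf a y * expR (- ((m * lam) * y)))%:E.
  have := @ge0_integral_scale R lam^-1 f li0.
  rewrite /f integral_gamma_pdf_expR// invrK => hs.
  transitivity (fine (lam^-1%:E * (\int[lebesgue_measure]_(x in `]0%R, +oo[)
     (gamma_pdf a (lam^-1 * x) * expR (- (m * lam * (lam^-1 * x))))%:E))%E).
    congr fine; rewrite -ge0_integralZl//.
    + apply: eq_integral => x; rewrite inE/= in_itv/= andbT => x0.
      by rewrite x0 -!EFinM mul1r mulrA -[m * lam * _]mulrA (mulrA lam) divff ?mul1r ?mulrA// gt_eqF.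
    + apply/measurable_EFinP; apply: measurable_funTS; apply: measurable_funM.
        apply: (measurableT_comp (measurable_gamma_pdf a)); exact: measurable_funM.
      apply: (measurableT_comp (me (m * lam))); exact: measurable_funM.
    + by move=> x _; rewrite lee_fin mulr_ge0 ?expR_ge0 ?gamma_pdf_ge0.
    + by rewrite lee_fin ltW.
  rewrite hs.
  + by rewrite -!EFinM mulrA mulVf ?mul1r// gt_eqF.
  + apply/measurable_EFinP; apply: measurable_funM => //; exact: measurable_gamma_pdf.
  + by move=> y; rewrite lee_fin mulr_ge0 ?expR_ge0 ?gamma_pdf_ge0.
Qed.

Lemma independent_gamma_sum_cdf (k : nat) (hk : (0 < k)%N)
    (a lam : 'I_k -> R) (X : 'I_k -> {RV P >-> R}) (r x : R) :
  (forall j, 0 < a j) -> (forall j, 0 < lam j) -> mutually_independent X ->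
  (forall j, has_density_on (X j) `]0, +oo[
     (fun x => (lam j)^-1 * gamma_pdf (a j) ((lam j)^-1 * x))) ->
  (fmax lam - fmin lam) / (fmax lam + fmin lam) < r -> r < 1 -> 0 <= x ->
  P [set t | \sum_(j < k) X j t <= x] =
  (vpar lam `^ (- \sum_(j < k) a j) * (\prod_(j < k) lam j `^ (- a j))
     * polar_integral a lam (\sum_(j < k) a j) r x)%:E.
Proof.
move=> a0 l0 indX dX hr r1 x0.
pose D := [set t | forall j, 0 < X j t].
have mX j : measurable_fun setT (X j) by [].
have mD : measurable D.
  rewrite (_ : D = \bigcap_(j in [set: 'I_k]) (X j @^-1` `]0, +oo[)).
    apply: fin_bigcap_measurable => // j _.
    by rewrite -[_ @^-1` _]setTI; apply: mX => //; exact: measurable_itv.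
  apply/seteqP; split => t tD j.
    by move=> _; rewrite /= in_itv/= andbT; exact: tD.
  by have := tD j Logic.I; rewrite /= in_itv/= andbT.
pose g (m : R) (y : R) : R := (0 < y)%R%:R * expR (- (m * y)).
have mg m : measurable_fun setT (g m).
  apply: measurable_funM.
    rewrite (_ : (fun _ => _) = \1_[set` `]0, +oo[]).
      by apply: measurable_indic; exact: measurable_itv.
    by apply/funext => t; rewrite indicE mem_setE in_itv/= andbT.
  by apply: measurableT_comp => //; apply: measurableT_comp => //; exact: measurable_funM.
have g01 m y : 0 <= m -> 0 <= g m y <= 1.
  move=> m0; rewrite /g; case: ltP => y0; rewrite ?mul0r ?lexx ?ler01// mul1r expR_ge0/=.
  by rewrite expR_le1 oppr_le0 mulr_ge0// ltW.
have mS : measurable_fun setT (fun t => \sum_(j < k) X j t).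
  by apply: measurable_sum => j.
(* The product of the truncated exponentials is the exponential of the sum, cut off outside [D];
   this ties independence to an integral over [D]. *)
have gE (m : R) t : \prod_(j < k) g m (X j t) =
    ((fun t => expR (- (m * \sum_(j < k) X j t))) \_ D) t.
  rewrite patchE; case: ifPn => [/set_mem tD|].
    rewrite mulr_sumr -sumrN expR_sum; apply: eq_bigr => j _.
    by rewrite /g tD mul1r.
  rewrite notin_setE/= => /existsNP[j /negP]; rewrite -leNgt => Xj.
  by rewrite (bigD1 j)//= /g ltNge Xj mul0r mul0r.
have hL (m : R) : 0 <= m -> \int[P]_(t in D) expR (- (m * \sum_(j < k) X j t)) =
     \prod_(j < k) (1 + m * lam j) `^ (- a j).
  move=> m0; rewrite Rintegral_mkcond.
  under eq_Rintegral do rewrite -gE.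
  rewrite (independent_expectation (g := fun=> g m))//; last by move=> _ y; exact: g01.
  by apply: eq_bigr => j _; rewrite /g (gamma_laplace (a0 j) (l0 j) m0 (dX j)).
(* Read off from the transform at [0]. *)
have PD : P D = 1%E.
  have := hL 0 (lexx _).
  under eq_Rintegral do rewrite mul0r oppr0 expR0.
  rewrite Rintegral_cst// mul1r big1 => [h|j _]; last by rewrite mul0r addr0 powR1.
  rewrite -[LHS]fineK ?fin_num_measure//.
  by congr EFin.
have PDy : (P D < +oo)%E by rewrite PD ltry.
rewrite (Rintegral_cdf _ mD PD)//; congr EFin.
have S0 t : D t -> 0 <= \sum_(j < k) X j t.
  by move=> tD; apply: sumr_ge0 => j _; rewrite ltW// tD.
exact: (gamma_sum_cdf hk a0 l0 mD PDy (measurable_funTS mS) S0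
  (fun m => hL m%:R (ler0n _ _)) hr r1 x0).
Qed.

End gamma_sums.

(** * Spectra, determinants and the law of a Gaussian quadratic form *)

Section gaussian_quadratic_forms.
Variable R : realType.

Lemma posdefmx_unit (k : nat) (A : 'M[R]_k) : posdefmx A -> A \in unitmx.
Proof. by move=> /gaussian_integral[A0 _]; rewrite unitmxE unitfE gt_eqF. Qed.

Lemma posdefmx_inv (k : nat) (A : 'M[R]_k) : posdefmx A -> posdefmx (invmx A).
Proof.
move=> pA; have uA := posdefmx_unit pA; have [sA qA] := pA.
split; first by rewrite trmx_inv sA.
move=> u u0; have v0 : invmx A *m u != 0.
  by apply: contra_neq u0 => h; rewrite -[u](mulKVmx uA) h mulmx0.
have := qA _ v0; rewrite trmx_mul trmx_inv sA.
by rewrite -!mulmxA (mulKVmx uA).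
Qed.

Lemma posdefmxDZ (k : nat) (A B : 'M[R]_k) (m : R) :
  0 <= m -> posdefmx A -> posdefmx B -> posdefmx (A + m *: B).
Proof.
move=> m0 [sA qA] [sB qB]; split; first by rewrite linearD linearZ/= sA sB.
move=> u u0; rewrite mulmxDr mulmxDl -scalemxAr -scalemxAl mxE [X in _ + X]mxE.
have qA0 := qA u u0; have qB0 := qB u u0.
by rewrite ltr_pwDl// mulr_ge0// ltW.
Qed.

Lemma det_spectrum (k : nat) (N : 'M[R]_k) (lam : 'I_k -> R) (x : R) :
  is_spectrum N lam -> \det (x%:M - N) = \prod_(j < k) (x - lam j).
Proof.
move=> h; transitivity ((char_poly N).[x]).
  rewrite /char_poly -horner_evalE -det_map_mx; congr (\det _).
  apply/matrixP => i j; rewrite !mxE /= /horner_eval !hornerE.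
  by case: (i == j); rewrite !hornerE.
by rewrite h horner_prod; apply: eq_bigr => j _; rewrite !hornerE.
Qed.

(** For $m\ne0$ the matrix is $-m\,(-m^{-1}I-N)$, so its determinant is a value of the
    characteristic polynomial. *)
Lemma det_spectrum1D (k : nat) (N : 'M[R]_k) (lam : 'I_k -> R) (m : R) :
  is_spectrum N lam -> \det (1%:M + m *: N) = \prod_(j < k) (1 + m * lam j).
Proof.
move=> h; have [->|m0] := eqVneq m 0.
  by rewrite scale0r addr0 det1 big1// => j _; rewrite mul0r addr0.
have -> : 1%:M + m *: N = (- m) *: ((- m^-1)%:M - N).
  rewrite scalerBr scale_scalar_mx mulrNN mulfV// scaleNr opprK//.
have -> : forall B : 'M[R]_k, \det (- m *: B) = (\prod_(j < k) - m) * \det B.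
  by move=> B; rewrite detZ prodr_const card_ord.
rewrite (det_spectrum _ h) -big_split/=; apply: eq_bigr => j _.
by field.
Qed.

Lemma det_is_spectrum (k : nat) (N : 'M[R]_k) (lam : 'I_k -> R) :
  is_spectrum N lam -> \det N = \prod_(j < k) lam j.
Proof.
move=> h; have := det_spectrum 0 h; rewrite raddf0 sub0r -scaleN1r.
have -> : forall B : 'M[R]_k, \det (-1 *: B) = (\prod_(j < k) (-1)) * \det B.
  by move=> B; rewrite detZ prodr_const card_ord.
move=> e; have : \prod_(j < k) (-1 : R) != 0 by apply/prodf_neq0 => j _; rewrite oppr_eq0 oner_eq0.
move=> /mulfI; apply; rewrite e -big_split/=.
by apply: eq_bigr => j _; rewrite sub0r mulN1r.
Qed.

Lemma posdefmx_conj (k : nat) (M C : 'M[R]_k) : posdefmx M -> posdefmx C ->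
  posdefmx (M *m C *m M).
Proof.
move=> pM [sC qC]; have uM := posdefmx_unit pM; have [sM _] := pM.
split; first by rewrite !trmx_mul sM sC mulmxA.
move=> u u0; have v0 : M *m u != 0.
  by apply: contra_neq u0 => h; rewrite -[u](mulKmx uM) h mulmx0.
by have := qC _ v0; rewrite trmx_mul sM !mulmxA.
Qed.

Lemma posdefmx_spectrum_gt0 (k : nat) (N : 'M[R]_k) (lam : 'I_k -> R) (j : 'I_k) :
  posdefmx N -> is_spectrum N lam -> 0 < lam j.
Proof.
move=> [sN qN] h; have : root (char_poly N) (lam j).
  by rewrite h rootE horner_prod (bigD1 j)//= !hornerE subrr mul0r.
rewrite -eigenvalue_root_char => /eigenvalueP[v vN v0].
have tv0 : v^T != 0 by apply: contra_neq v0 => h0; rewrite -[v]trmxK h0 trmx0.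
have := qN _ tv0; rewrite trmxK vN -scalemxAl mxE => vv.
have v2 : 0 <= (v *m v^T) 0 0.
  by rewrite mxE sumr_ge0// => i _; rewrite mxE -expr2 sqr_ge0.
rewrite ltNge; apply/negP => l0; move: vv; rewrite ltNge => /negP; apply.
exact: mulr_le0_ge0.
Qed.

(** The two matrices are conjugate: $(I+mM^2C)M=M(I+mMCM)$. *)
Lemma det1D_sqrt (k : nat) (M C : 'M[R]_k) (m : R) : M \in unitmx ->
  \det (1%:M + m *: (M *m M *m C)) = \det (1%:M + m *: (M *m C *m M)).
Proof.
move=> uM; have M0 : \det M != 0 by rewrite -unitfE -unitmxE.
apply: (mulIf M0); rewrite [RHS]mulrC -!det_mulmx mulmxDl mulmxDr mul1mx mulmx1.
by rewrite -scalemxAl -scalemxAr !mulmxA.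
Qed.

End gaussian_quadratic_forms.

Lemma qformDZ (R : realType) (k : nat) (A B : 'M[R]_k) (m : R) (u : 'cV[R]_k) :
  qform (A + m *: B) u = qform A u + m * qform B u.
Proof.
by rewrite /qform mulmxDr mulmxDl -scalemxAr -scalemxAl mxE [X in _ + X]mxE.
Qed.

Lemma powR_prod (R : realType) (k : nat) (y : 'I_k -> R) (s : R) :
  (forall j, 0 <= y j) -> (\prod_(j < k) y j) `^ s = \prod_(j < k) y j `^ s.
Proof.
move=> y0; suff [] : 0 <= \prod_(j < k) y j /\
  (\prod_(j < k) y j) `^ s = \prod_(j < k) y j `^ s by [].
elim/big_rec2: _ => [|j q p _ [p0 <-]]; first by rewrite powR1.
by rewrite powRM// mulr_ge0.
Qed.

Lemma quad_formE (R : realType) (T : Type) (k : nat) (C : 'M[R]_k)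
    (X : 'I_k -> T -> R) (t : T) :
  quad_form C X t = qform C (\col_j tnth [tuple X j t | j < k] j).
Proof.
rewrite /quad_form -/(qform C _); congr qform.
by apply/matrixP => i j; rewrite !mxE tnth_mktuple.
Qed.

Section gaussian_quadratic_form_cdf.
Context d (T : measurableType d) (R : realType) (P : probability T R).
Variables (k : nat) (X : 'I_k -> {RV P >-> R}) (Sigma C M : 'M[R]_k) (lam : 'I_k -> R).
Hypotheses (pSigma : posdefmx Sigma) (pC : posdefmx C)
  (gX : gaussian_vector X Sigma) (sqM : is_sqrtmx M Sigma)
  (specM : is_spectrum (M *m C *m M) lam).

(** The density times $e^{-mQ/2}$ is a Gaussian integrand for $A=\Sigma^{-1}+mC$. The powers of
    $2\pi$ cancel, and $|\Sigma||A|=|I+m\Sigma C|=|I+mMCM|$ with $\Sigma=M^2$. *)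
Lemma gaussian_quadratic_laplace (m : R) : 0 <= m ->
  \int[P]_t expR (- (m * (2^-1 * quad_form C X t))) =
  \prod_(j < k) (1 + m * lam j) `^ (- 2^-1).
Proof.
move=> m0; have [pM MM] := sqM.
have S0 := (gaussian_integral pSigma).1.
have uS := posdefmx_unit pSigma; have uM := posdefmx_unit pM.
pose A := invmx Sigma + m *: C.
have [A0 hA] := gaussian_integral (posdefmxDZ m0 (posdefmx_inv pSigma) pC).
have l0 j : 0 < lam j := posdefmx_spectrum_gt0 j (posdefmx_conj pM pC) specM.
pose phi (u : k.-tuple R) : \bar R :=
  (expR (- (m * (2^-1 * qform C (\col_j tnth u j)))))%:E.
have mphi : measurable_fun setT phi.
  apply/measurable_EFinP; apply: measurableT_comp => //.
  apply: measurableT_comp => //; apply: measurable_funM => //.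
  by apply: measurable_funM => //; exact: measurable_qform.
have phi0 u : (0 <= phi u)%E by rewrite lee_fin expR_ge0.
rewrite /Rintegral.
transitivity (fine (\int[P]_t phi [tuple X j t | j < k])%E).
  by congr fine; apply: eq_integral => t _; rewrite /phi quad_formE.
rewrite (gaussian_expectation gX mphi phi0).
pose c : R := (2 * pi) `^ (- (k%:R / 2)) * (\det Sigma) `^ (- 2^-1).
have c0 : 0 <= c by rewrite mulr_ge0 ?powR_ge0.
pose f (u : k.-tuple R) : \bar R :=
  (expR (- (2^-1 * (0 + qform A (\col_j tnth u j + 0)))))%:E.
have mf : measurable_fun setT f.
  apply/measurable_EFinP; apply: measurableT_comp => //.
  apply: measurableT_comp => //; apply: measurable_funM => //.
  apply: measurable_funD => //.
  rewrite (_ : (fun _ => _) = fun u : k.-tuple R => qform A (\col_j tnth u j)).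
    exact: measurable_qform.
  by apply/funext => u; rewrite addr0.
have f0 u : (0 <= f u)%E by rewrite lee_fin expR_ge0.
have [_ ITZ _] := positive_functional_integral_tuple R k.
have -> : (fun u => (gaussian_pdf Sigma u)%:E * phi u)%E = (fun u => c%:E * f u)%E.
  apply/funext => u; rewrite /gaussian_pdf /phi /f -!EFinM -/c -mulrA -expRD.
  congr (_ * expR _)%:E; rewrite add0r addr0 /A qformDZ mulrDr opprD.
  by congr (_ - _); rewrite mulrCA.
rewrite ITZ// hA mulr0 oppr0 expR0 mulr1 -EFinM/= /c.
have p0 : 0 < 2 * pi :> R by rewrite mulr_gt0 ?pi_gt0.
rewrite mulrACA -powRD; last by rewrite (gt_eqF p0) implybT.
rewrite addNr powRr0 mul1r -(powRM _ (ltW S0) (ltW A0)).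
have -> : \det Sigma * \det A = \prod_(j < k) (1 + m * lam j).
  rewrite -det_mulmx mulmxDr mulmxV// -scalemxAr -MM det1D_sqrt//.
  exact: det_spectrum1D.
by rewrite powR_prod// => j; rewrite addr_ge0// mulr_ge0// ltW.
Qed.

Lemma gaussian_quadratic_cdf (hk : (0 < k)%N) (r x : R) :
  (fmax lam - fmin lam) / (fmax lam + fmin lam) < r -> r < 1 -> 0 <= x ->
  P [set t | 2^-1 * quad_form C X t <= x] =
  (vpar lam `^ (- (k%:R / 2)) * \det (C *m Sigma) `^ (- 2^-1)
     * polar_integral (fun=> 2^-1) lam (k%:R / 2) r x)%:E.
Proof.
move=> hr r1 x0; have [pM MM] := sqM.
have l0 j : 0 < lam j := posdefmx_spectrum_gt0 j (posdefmx_conj pM pC) specM.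
have kE : \sum_(j < k) 2^-1 = k%:R / 2 :> R.
  by rewrite sumr_const card_ord -[LHS]mulr_natl.
have dE : \det (C *m Sigma) `^ (- 2^-1) = \prod_(j < k) lam j `^ (- 2^-1).
  (* Both sides are $|M|^2|C|$. *)
  have -> : \det (C *m Sigma) = \prod_(j < k) lam j.
    rewrite -(det_is_spectrum specM) -MM !det_mulmx; ring.
  by rewrite powR_prod// => j; exact/ltW/l0.
have mX j : measurable_fun setT (X j) by [].
have mQ : measurable_fun setT (fun t => 2^-1 * quad_form C X t).
  apply: measurable_funM => //.
  have mY : measurable_fun setT (fun t => [tuple X j t | j < k]).
    apply/measurable_fun_tnthP => i; rewrite (_ : _ \o _ = X i)//.
    by apply/funext => t; rewrite /= tnth_mktuple.
  rewrite (_ : quad_form C X = (fun u : k.-tuple R => qform C (\col_j tnth u j)) \o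
     (fun t => [tuple X j t | j < k])).
    exact: (measurableT_comp (measurable_qform C) mY).
  by apply/funext => t; rewrite quad_formE.
have Q0 t : setT t -> 0 <= 2^-1 * quad_form C X t.
  move=> _; rewrite mulr_ge0 ?invr_ge0// quad_formE.
  set u := \col_j _; have [->|u0] := eqVneq u 0; first by rewrite /qform mulmx0 mxE.
  by apply: ltW; case: pC => _; apply.
have PT : P setT = 1%E := probability_setT P.
have PTy : (P setT < +oo)%E by rewrite PT ltry.
rewrite (Rintegral_cdf x measurableT PT mQ) dE -kE; congr EFin.
have h20 (j : 'I_k) : 0 < 2^-1 :> R by rewrite invr_gt0.
exact: (gamma_sum_cdf hk h20 l0 measurableT PTy mQ Q0
  (fun m => gaussian_quadratic_laplace (ler0n _ m)) hr r1 x0).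
Qed.

End gaussian_quadratic_form_cdf.

Theorem mainTheorem1 (R : realType) (d : measure_display)
    (T : measurableType d) (P : probability T R) (k : nat) (hk : (0 < k)%N) :
  (forall (a lam : 'I_k -> R) (X : 'I_k -> {RV P >-> R}),
     (forall j, 0 < a j) ->
     (forall j, 0 < lam j) ->
     mutually_independent X ->
     (forall j, has_density_on (X j) `]0, +oo[
                  (fun x => (lam j)^-1 * gamma_pdf (a j) ((lam j)^-1 * x))) ->
     let alpha := \sum_(j < k) a j in
     forall r x : R,
       (fmax lam - fmin lam) / (fmax lam + fmin lam) < r -> r < 1 -> 0 <= x ->
       P [set t | \sum_(j < k) X j t <= x] =
       (vpar lam `^ (- alpha) * (\prod_(j < k) lam j `^ (- a j))
          * polar_integral a lam alpha r x)%:E)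
  /\
  (forall (X : 'I_k -> {RV P >-> R}) (Sigma C M : 'M[R]_k) (lam : 'I_k -> R),
     posdefmx Sigma ->
     posdefmx C ->
     gaussian_vector X Sigma ->
     is_sqrtmx M Sigma ->
     is_spectrum (M *m C *m M) lam ->
     forall r x : R,
       (fmax lam - fmin lam) / (fmax lam + fmin lam) < r -> r < 1 -> 0 <= x ->
       P [set t | 2^-1 * quad_form C X t <= x] =
       (vpar lam `^ (- (k%:R / 2)) * \det (C *m Sigma) `^ (- 2^-1)
          * polar_integral (fun=> 2^-1) lam (k%:R / 2) r x)%:E).
Proof.
split.
- move=> a lam X a0 l0 iX dX alpha r x hr r1 x0.
  exact: independent_gamma_sum_cdf.
- move=> X Sigma C M lam pS pC gX sM spM r x hr r1 x0.
  exact: (gaussian_quadratic_cdf pS pC gX sM spM hk hr r1 x0).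
Qed.
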